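(* For every integer $n \geq 1$ and every nonnegative integer $r$, $$\frac{1}{n!} \sum_{\lambda \vdash n} f_{\lambda}^2 \sum_{u \in \lambda} \prod_{i=1}^{r}(h_u^2 - i^2) = \frac{1}{2(r+1)^2} \binom{2r}{r}\binom{2r+2}{r+1} \prod_{j=0}^{r} (n-j).$$
   Context: The outer sum runs over all partitions $\lambda$ of $n$, identified with their Young diagrams (sets of cells $u=(i,j)$). $f_\lambda$ denotes the number of standard Young tableaux of shape $\lambda$. For a cell $u=(i,j)\in\lambda$, the hook length $h_u$ is $\lambda_i - j + \lambda'_j - i + 1$, i.e. the number of cells directly to the right of $u$, directly below $u$, plus one ($\lambda'$ is the conjugate partition). An empty product equals $1$. *)

(* Defs.v *)
From HB Require Import structures.
From mathcomp Require Import all_boot all_order all_algebra.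

Set Implicit Arguments.
Unset Strict Implicit.
Unset Printing Implicit Defensive.

Definition is_intpart (s : seq nat) : bool := sorted geq s && (0 \notin s).

Record intpart (n : nat) : Type := IntPart {
  parts :> seq nat;
  _ : is_intpart parts && (sumn parts == n)
}.

HB.instance Definition _ n := [isSub for @parts n].
HB.instance Definition _ n := [Countable of intpart n by <:].

(* Finiteness of [intpart n]: a partition of n has at most n parts, each at
   most n, so it embeds in the sequences of size at most n over 'I_n.+1. *)
Section IntPartFinite.

Variable n : nat.

Definition intpart_enc (la : intpart n) : n.-bseq 'I_n.+1 :=
  insub_bseq n [seq inord p | p <- la].

Definition intpart_dec (b : n.-bseq 'I_n.+1) : option (intpart n) :=
  insub [seq val p | p <- b].

Lemma intpart_encK : pcancel intpart_enc intpart_dec.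
Proof.
case=> s sP; have /andP[/andP[_ s0] /eqP sn] := sP.
have sz : size s <= n.
  rewrite -sn; elim: s s0 {sP sn} => //= p s IHs.
  rewrite inE negb_or eq_sym -lt0n => /andP[p_gt0 /IHs].
  by rewrite -add1n; apply: leq_add.
have le_n p : p \in s -> p < n.+1.
  rewrite ltnS -sn; elim: s {sP s0 sn sz} => //= q s IHs.
  rewrite inE => /predU1P[->|/IHs]; first exact: leq_addr.
  by move/leq_trans; apply; apply: leq_addl.
rewrite /intpart_dec /intpart_enc /insub_bseq /= insubdK; last first.
  by rewrite unfold_in /= size_map.
rewrite -map_comp map_id_in; last by move=> p /le_n lt_p /=; rewrite inordK.
by rewrite insubT; congr Some; apply: val_inj.
Qed.

End IntPartFinite.

HB.instance Definition _ n : isFinite (intpart n) :=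
  PCanIsFinite (@intpart_encK n).

(* Cells are 0-based: the cell (i, j) of the Young diagram in matrix
   coordinates is the pair (i - 1, j - 1), with j - 1 < la_i. *)
Definition cell (la : seq nat) : Type := {i : 'I_(size la) & 'I_(nth 0 la i)}.

Definition crow (la : seq nat) (u : cell la) : nat := tag u.
Definition ccol (la : seq nat) (u : cell la) : nat := tagged u.

(* The part of index j (from 0) of the conjugate partition. *)
Definition conj_part (la : seq nat) (j : nat) : nat := count (ltn j) la.

(* With 0-based coordinates, la_i - j and la'_j - i become the arm and leg
   below; both subtractions are exact when la is a partition. *)
Definition hook_length (la : seq nat) (u : cell la) : nat :=
  (nth 0 la (crow u) - (ccol u).+1) + (conj_part la (ccol u) - (crow u).+1) + 1.

(* Entries are 0, ..., |la| - 1 instead of 1, ..., |la|. *)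
Definition is_SYT (la : seq nat) (T : {ffun cell la -> 'I_(sumn la)}) : bool :=
  [&& [forall k, #|[set u | T u == k]| == 1],
      [forall u, forall v,
         (crow u == crow v) && (ccol u < ccol v) ==> (T u < T v)]
    & [forall u, forall v,
         (ccol u == ccol v) && (crow u < crow v) ==> (T u < T v)]].

Definition num_SYT (la : seq nat) : nat :=
  #|[set T : {ffun cell la -> 'I_(sumn la)} | is_SYT T]|.

(* Main.v *)
(* For even g, summing g over the hook lengths of a partition is expressed
   through contents: twice the sum is twice the sum of g over the contents plus
   the sum of the second difference of g over all differences of two contents.
   For g(x) = prod_(i = 1..r) (x^2 - i^2) this is a polynomial in the power sums
   p_a of the contents, of weight 2 r + 2 when p_a has weight a + 2.  Adding a
   cell of content c to a partition changes such a polynomial by a polynomial in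
   c and the p_a of weight smaller by 2, c having weight 1.  The moments of c
   under the transition probabilities f_(la + c) / ((n + 1) f_la) are complete
   symmetric functions of an interlacing pair of sequences, hence polynomials in
   the p_a by Newton's identities.  So the Plancherel average is a polynomial in
   n of degree at most r + 1.  It vanishes for n <= r, because all hook lengths
   are then at most r, and for n = r + 1 only the corner of a hook shape
   contributes, which gives the sum of C(r, b)^2 over b. *)

Require Import Defs.
From mathcomp Require Import all_boot all_order all_algebra.
From mathcomp Require Import ring zify.

Set Implicit Arguments.
Unset Strict Implicit.
Unset Printing Implicit Defensive.

Import Order.TTheory GRing.Theory Num.Theory.

(** * Partitions *)

Lemma sumn_incr_nth (s : seq nat) i : sumn (incr_nth s i) = (sumn s).+1.
Proof.
elim: s i => [|p s IH] [|i] //=; first by rewrite sumn_ncons /= mul0n add0n.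
by rewrite IH addnS.
Qed.

Lemma leq_size_incr_nth (s : seq nat) i : size s <= size (incr_nth s i).
Proof. by rewrite size_incr_nth; case: ltnP => // /leqW. Qed.

Lemma ltn_size_nth (s : seq nat) i j : j < nth 0 s i -> i < size s.
Proof. by rewrite [i < _]ltnNge; apply: contraTN => le_i; rewrite nth_default. Qed.

Lemma size_leq_sumn (s : seq nat) : 0 \notin s -> size s <= sumn s.
Proof.
elim: s => //= p s IH; rewrite inE negb_or eq_sym -lt0n => /andP[p_gt0 /IH].
by lia.
Qed.

Lemma nth_size_leq_sumn (s : seq nat) i :
  0 \notin s -> i < size s -> nth 0 s i + size s <= (sumn s).+1.
Proof.
elim: s i => // p s IH [|i] /=; rewrite inE negb_or eq_sym -lt0n => /andP[p_gt0 s_pos].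
  by have := size_leq_sumn s_pos; lia.
by move=> /(IH _ s_pos); lia.
Qed.

Lemma is_intpartP (la : seq nat) : reflect
  ((forall i, nth 0 la i.+1 <= nth 0 la i) /\ (forall i, i < size la -> 0 < nth 0 la i))
  (is_intpart la).
Proof.
apply: (iffP andP) => -[dec pos]; split.
- move=> i; case: (ltnP i.+1 (size la)) => [|/(nth_default 0) -> //].
  exact: (sortedP 0 dec).
- by move=> i lt_i; rewrite lt0n; apply: contraNneq pos => <-; apply: mem_nth.
- by apply/(sortedP 0) => i _; apply: dec.
- by apply/(nthP 0) => -[i /pos lt_i eq0]; rewrite eq0 in lt_i.
Qed.

Lemma intpart_is_intpart n (la : intpart n) : is_intpart la.
Proof. by have /andP[] := valP la. Qed.

Lemma sumn_intpart n (la : intpart n) : sumn la = n.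
Proof. by have /andP[_ /eqP] := valP la. Qed.

Lemma size_intpart_leq (la : seq nat) : is_intpart la -> size la <= sumn la.
Proof. by case/andP => _ /size_leq_sumn. Qed.

Lemma nth_intpart_leq (la : seq nat) i j :
  is_intpart la -> i <= j -> nth 0 la j <= nth 0 la i.
Proof.
move=> /is_intpartP[dec _] /subnK <-; elim: (j - i) => // k IH.
exact: leq_trans (dec _) IH.
Qed.

Lemma eq_intpart (la mu : seq nat) :
  is_intpart la -> is_intpart mu -> nth 0 la =1 nth 0 mu -> la = mu.
Proof.
move=> /is_intpartP[_ pos_la] /is_intpartP[_ pos_mu] eq_nth.
apply: (@eq_from_nth _ 0) => //.
apply/eqP; rewrite eqn_leq; apply/andP; split; rewrite leqNgt; apply/negP.
- by move=> /pos_la; rewrite eq_nth nth_default.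
- by move=> /pos_mu; rewrite -eq_nth nth_default.
Qed.

Lemma incr_nth_intpart_inj i :
  {in is_intpart &, injective (fun la => incr_nth la i)}.
Proof.
move=> la mu la_part mu_part eq_incr; apply: eq_intpart => // j.
by have := congr1 (nth 0 ^~ j) eq_incr; rewrite !nth_incr_nth => /addnI.
Qed.

Lemma is_intpart_incr (la : seq nat) i : is_intpart la ->
  is_intpart (incr_nth la i) = (i == 0) || (nth 0 la i < nth 0 la i.-1).
Proof.
move=> la_part; have /is_intpartP[dec pos] := la_part.
apply/is_intpartP/idP => [[dec' _]|add_i].
  by case: i dec' => // i /(_ i); rewrite !nth_incr_nth eqxx (gtn_eqF (ltnSn i)).
have le_i : i <= size la.
  by case: i add_i => // i /(leq_ltn_trans (leq0n _))/ltn_size_nth.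
split=> j; rewrite ?size_incr_nth !nth_incr_nth.
  have := dec j; case: (i =P j.+1) add_i => [->|_] /=; first by case: eqP; lia.
  by case: eqP; lia.
case: (ltnP i (size la)) => [_ /pos|le_size lt_j]; first by case: eqP; lia.
by case: eqP => // ij; apply/pos; lia.
Qed.

Definition removable (la : seq nat) i : bool := nth 0 la i.+1 < nth 0 la i.

Definition decr_part (la : seq nat) i : seq nat :=
  if nth 0 la i == 1 then take i la else set_nth 0 la i (nth 0 la i).-1.

Lemma removable_incr (la : seq nat) i : is_intpart la -> removable (incr_nth la i) i.
Proof.
move=> /is_intpartP[/(_ i) dec _]; rewrite /removable !nth_incr_nth eqxx.
by rewrite (ltn_eqF (ltnSn i)).
Qed.

Section RemoveCell.

Variables (la : seq nat) (i : nat).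
Hypotheses (la_part : is_intpart la) (rem_i : removable la i).

Lemma removable_size : i < size la.
Proof. exact: ltn_size_nth rem_i. Qed.

Lemma nth_decr_part j : nth 0 (decr_part la i) j = nth 0 la j - (i == j).
Proof.
move: rem_i; rewrite /removable /decr_part => lt_i.
case: eqP => [la_i|_].
  case: (ltnP j i) => [lt_ji|le_ij]; first by rewrite nth_take // gtn_eqF ?subn0.
  rewrite nth_default ?size_take_min ?geq_min ?le_ij //.
  case: eqP => [<-|ne_ij]; first by rewrite la_i.
  by have := @nth_intpart_leq _ i.+1 j la_part; lia.
by rewrite nth_set_nth /= [j == i]eq_sym; case: eqP => [->|_]; lia.
Qed.

Lemma incr_decr_part : incr_nth (decr_part la i) i = la.
Proof.
have lt_i := removable_size.
apply: (@eq_from_nth _ 0) => [|j _]; last first.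
  rewrite nth_incr_nth nth_decr_part; move: rem_i; rewrite /removable.
  by case: eqP => [->|_]; lia.
rewrite size_incr_nth; move: rem_i; rewrite /removable /decr_part.
case: eqP => [la_i rem|_ _]; last by rewrite size_set_nth (maxn_idPr lt_i) lt_i.
rewrite size_take lt_i ltnn; apply/eqP; rewrite eqn_leq lt_i leqNgt; apply/negP.
by have /is_intpartP[_ pos] := la_part; move=> /pos; lia.
Qed.

Lemma sumn_decr_part : sumn la = (sumn (decr_part la i)).+1.
Proof. by rewrite -{1}incr_decr_part sumn_incr_nth. Qed.

Lemma size_decr_part : size (decr_part la i) <= size la.
Proof. by rewrite -{2}incr_decr_part leq_size_incr_nth. Qed.

Lemma decr_part_is_intpart : is_intpart (decr_part la i).
Proof.
have /is_intpartP[dec pos] := la_part.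
apply/is_intpartP; split=> [j|j lt_j].
  rewrite !nth_decr_part; have := dec j; move: rem_i; rewrite /removable.
  by case: (i =P j) => [->|_]; case: eqP => [->|_]; lia.
rewrite nth_decr_part; have := pos j (leq_trans lt_j size_decr_part).
case: eqP => [ij|]; last by lia.
move: lt_j; rewrite -ij /decr_part; case: eqP => [_|]; last by lia.
by rewrite size_take removable_size ltnn.
Qed.

End RemoveCell.

(** * Branching of standard Young tableaux *)

Section Cells.

Variable la : seq nat.
Implicit Types u v : cell la.

Lemma cell_inj u v : crow u = crow v -> ccol u = ccol v -> u = v.
Proof.
case: u v => [i j] [i' j']; rewrite /crow /ccol /= => /val_inj eq_i.
by case: i' / eq_i j' => j' /val_inj ->.
Qed.

Lemma crow_lt u : crow u < size la.
Proof. exact: ltn_ord. Qed.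

Lemma ccol_lt u : ccol u < nth 0 la (crow u).
Proof. exact: ltn_ord. Qed.

Lemma hook_length_gt0 u : 0 < hook_length u.
Proof. by rewrite /hook_length addn1. Qed.

Definition cell_at i j (lt_j : j < nth 0 la i) : cell la :=
  Tagged (fun i : 'I_(size la) => 'I_(nth 0 la i))
    (Ordinal lt_j : 'I_(nth 0 la (Ordinal (ltn_size_nth lt_j)))).

Lemma card_cell : #|{: cell la}| = sumn la.
Proof.
rewrite card_tagged; congr (sumn _).
apply: (@eq_from_nth _ 0); rewrite size_map -cardE card_ord // => i lt_i.
by rewrite (nth_map (Ordinal lt_i)) -?cardE ?card_ord // nth_enum_ord.
Qed.

Definition precedes u v : bool :=
  (crow u == crow v) && (ccol u < ccol v) || (ccol u == ccol v) && (crow u < crow v).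

Definition is_tableau m (T : {ffun cell la -> 'I_m}) : bool :=
  injectiveb T && [forall u, forall v, precedes u v ==> (T u < T v)].

Lemma is_tableauP m (T : {ffun cell la -> 'I_m}) :
  reflect (injective T /\ forall u v, precedes u v -> T u < T v) (is_tableau T).
Proof.
apply: (iffP andP) => -[injT incrT]; split.
- exact/injectiveP.
- by move=> u v; apply/implyP; move/forallP/(_ u)/forallP: incrT.
- exact/injectiveP.
- by apply/forallP => u; apply/forallP => v; apply/implyP/incrT.
Qed.

Lemma tableau_surj m (T : {ffun cell la -> 'I_m}) k :
  sumn la = m -> injective T -> exists u, T u = k.
Proof.
move=> sum_la injT; have := inj_card_onto injT.
by rewrite card_cell card_ord sum_la leqnn => /(_ isT k)/codomP[u ->]; exists u.
Qed.

Lemma is_SYT_tableau (T : {ffun cell la -> 'I_(sumn la)}) : is_SYT T = is_tableau T.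
Proof.
rewrite /is_SYT /is_tableau; congr (_ && _).
  apply/forallP/injectiveP => [fibT u v eqT | injT k].
    have /cards1P[w fib_w] := fibT (T v).
    have: v \in [set u | T u == T v] by rewrite inE.
    have: u \in [set u | T u == T v] by rewrite inE eqT.
    by rewrite fib_w !inE => /eqP-> /eqP->.
  have [u Tu] := tableau_surj k erefl injT.
  by apply/cards1P; exists u; apply/setP => v; rewrite !inE -Tu (inj_eq injT).
apply/andP/forallP => [[/forallP rows /forallP cols] u | incrT].
  apply/forallP => v; apply/implyP => /orP[]; apply: implyP.
    exact: forallP (rows u) v.
  exact: forallP (cols u) v.
split; apply/forallP => u; apply/forallP => v; apply/implyP => uv;
  by apply: (implyP (forallP (incrT u) v)); rewrite /precedes uv ?orbT.
Qed.

Lemma num_SYT_tableau m : sumn la = m ->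
  num_SYT la = #|[set T : {ffun cell la -> 'I_m} | is_tableau T]|.
Proof. by move=> <-; apply: eq_card => T; rewrite !inE is_SYT_tableau. Qed.

End Cells.

Section AddCell.

Variables (la : seq nat) (i m : nat).
Hypothesis la_part : is_intpart la.
Local Notation La := (incr_nth la i).
Implicit Types (T : {ffun cell la -> 'I_m}) (S : {ffun cell La -> 'I_m.+1}).

Lemma ccol_lt_incr (v : cell la) : ccol v < nth 0 La (crow v).
Proof. by rewrite nth_incr_nth (leq_trans (ccol_lt v)) ?leq_addl. Qed.

Lemma ltn_nth_incr : nth 0 la i < nth 0 La i.
Proof. by rewrite nth_incr_nth eqxx. Qed.

Definition embed_cell (v : cell la) : cell La := cell_at (ccol_lt_incr v).
Definition added_cell : cell La := cell_at ltn_nth_incr.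

Variant incr_cell_spec : cell La -> Prop :=
| EmbeddedCell v : incr_cell_spec (embed_cell v)
| AddedCell : incr_cell_spec added_cell.

Lemma incr_cellP u : incr_cell_spec u.
Proof.
have := ccol_lt u; rewrite nth_incr_nth => lt_u.
case: (ltnP (ccol u) (nth 0 la (crow u))) => [lt_col | le_col].
  by rewrite (_ : u = embed_cell (cell_at lt_col)); [constructor | apply: cell_inj].
case: eqP lt_u => [row_u|_]; last by rewrite ltnNge le_col.
move: le_col; rewrite -row_u => le_col lt_u.
rewrite (_ : u = added_cell); first by constructor.
by apply: cell_inj => //; apply/eqP; rewrite eqn_leq le_col -ltnS lt_u.
Qed.

Lemma embed_cell_inj : injective embed_cell.
Proof.
move=> v w eq_vw; apply: cell_inj; first exact: (congr1 (@crow _) eq_vw).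
exact: (congr1 (@ccol _) eq_vw).
Qed.

Lemma embed_neq_added v : embed_cell v != added_cell.
Proof.
apply/eqP => eq_v; have row_v : crow v = i := congr1 (@crow _) eq_v.
have col_v : ccol v = nth 0 la i := congr1 (@ccol _) eq_v.
by have := ccol_lt v; rewrite row_v col_v ltnn.
Qed.

Lemma precedes_embed v w : precedes (embed_cell v) (embed_cell w) = precedes v w.
Proof. by []. Qed.

Lemma added_precedes u : ~~ precedes added_cell u.
Proof.
rewrite /precedes /crow /ccol /= -/(crow u) -/(ccol u) negb_or !negb_and -!leqNgt.
case: (incr_cellP u) => [v|]; last by rewrite !leqnn !orbT.
have := ccol_lt v; have := @nth_intpart_leq _ i (crow v) la_part.
rewrite /crow /ccol /= -/(crow v) -/(ccol v).
by case: (i =P crow v) => [->|_] /=; case: eqP => //=; lia.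
Qed.

Definition extend_tableau T : {ffun cell La -> 'I_m.+1} :=
  [ffun u => if [pick v | embed_cell v == u] is Some v then lift ord_max (T v)
             else ord_max].

Lemma extend_embed T v : extend_tableau T (embed_cell v) = lift ord_max (T v).
Proof. by rewrite ffunE; case: pickP => [w /eqP/embed_cell_inj-> //|/(_ v)/eqP]. Qed.

Lemma extend_added T : extend_tableau T added_cell = ord_max.
Proof. by rewrite ffunE; case: pickP => // v; rewrite (negPf (embed_neq_added v)). Qed.

Lemma extend_tableau_inj : injective extend_tableau.
Proof.
move=> T T' eqT; apply/ffunP => v; apply: (@lift_inj _ ord_max).
by rewrite -!extend_embed eqT.
Qed.

Lemma is_tableau_extend T : is_tableau (extend_tableau T) = is_tableau T.
Proof.
apply/is_tableauP/is_tableauP => -[injT incrT]; split.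
- move=> v w eqT; apply/embed_cell_inj/injT.
  by rewrite !extend_embed eqT.
- by move=> v w; rewrite -precedes_embed => /incrT; rewrite !extend_embed !lift_max.
- move=> u w; case: (incr_cellP u) => [v|]; case: (incr_cellP w) => [v'|] //.
  + by rewrite !extend_embed => /lift_inj/injT->.
  + by rewrite extend_embed extend_added => /esym/eqP; rewrite (negPf (neq_lift _ _)).
  + by rewrite extend_embed extend_added => /eqP; rewrite (negPf (neq_lift _ _)).
- move=> u w; case: (incr_cellP u) => [v|]; last by rewrite (negPf (added_precedes _)).
  case: (incr_cellP w) => [v'|_]; last by rewrite extend_embed extend_added lift_max /=.
  by rewrite !extend_embed !lift_max; apply: incrT.
Qed.

Lemma tableau_extend S : is_tableau S -> S added_cell = ord_max ->
  exists T, S = extend_tableau T.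
Proof.
move=> /is_tableauP[injS _] S_added.
have /fin_all_exists[T TE] v : exists k, S (embed_cell v) = lift ord_max k.
  case: (unliftP ord_max (S (embed_cell v))) => [k -> | ]; first by exists k.
  by rewrite -S_added => /injS/eqP; rewrite (negPf (embed_neq_added v)).
exists (finfun T); apply/ffunP => u; case: (incr_cellP u) => [v|].
  by rewrite extend_embed ffunE.
by rewrite extend_added.
Qed.

Lemma row_of_max_entry S u :
  is_tableau S -> S u = ord_max -> (crow u == i) = (S added_cell == ord_max).
Proof.
move=> /is_tableauP[injS incrS] Su.
have <- : (u == added_cell) = (S added_cell == ord_max).
  by rewrite -Su (inj_eq injS) eq_sym.
apply/eqP/eqP => [|->] //; case: (incr_cellP u) Su => // v Sv row_v.
have /incrS : precedes (embed_cell v) added_cell.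
  rewrite /precedes row_v eqxx; apply/orP; left; rewrite /= /ccol /= -/(ccol v).
  by rewrite -row_v; apply: ccol_lt.
by rewrite Sv ltnNge leq_ord.
Qed.

Lemma card_tableau_incr :
  #|[set S : {ffun cell La -> 'I_m.+1} | is_tableau S &
       [exists u, (S u == ord_max) && (crow u == i)]]|
  = #|[set T : {ffun cell la -> 'I_m} | is_tableau T]|.
Proof.
rewrite -(card_imset _ extend_tableau_inj); apply: eq_card => S; rewrite inE.
apply/andP/imsetP => [[tabS /existsP[u /andP[/eqP Su]]] | [T]].
  rewrite (row_of_max_entry tabS Su) => /eqP/(tableau_extend tabS)[T eqS].
  by exists T; rewrite // inE -is_tableau_extend -eqS.
rewrite inE -is_tableau_extend => tabT ->; split=> //.
by apply/existsP; exists added_cell; rewrite extend_added !eqxx.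
Qed.

End AddCell.

Lemma max_entry_removable (la : seq nat) m (T : {ffun cell la -> 'I_m.+1}) u :
  is_tableau T -> T u = ord_max -> removable la (crow u).
Proof.
move=> /is_tableauP[_ incrT] Tu; apply: leq_trans (ccol_lt u).
rewrite ltnS leqNgt; apply/negP => lt_u; pose v := cell_at lt_u.
have /incrT : precedes u v by rewrite /precedes /crow /= ltnSn eqxx orbT.
by rewrite Tu ltnNge leq_ord.
Qed.

Theorem num_SYT_branching (la : seq nat) n : is_intpart la -> sumn la = n.+1 ->
  num_SYT la = \sum_(i < n.+1 | removable la i) num_SYT (decr_part la i).
Proof.
move=> la_part sum_la; rewrite (num_SYT_tableau sum_la) -sum1_card.
pose max_in_row i (T : {ffun cell la -> 'I_n.+1}) :=
  [exists u, (T u == ord_max) && (crow u == i)].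
transitivity (\sum_(T : {ffun cell la -> 'I_n.+1} | is_tableau T)
                \sum_(i < n.+1 | removable la i && max_in_row i T) 1).
  apply: eq_big => [T | T]; rewrite inE // => tabT.
  have [u Tu] := tableau_surj ord_max sum_la (is_tableauP _ tabT).1.
  have lt_u : crow u < n.+1.
    by rewrite -sum_la (leq_trans (crow_lt u)) ?size_intpart_leq.
  rewrite (big_pred1 (Ordinal lt_u)) // => i /=; rewrite -val_eqE /=.
  apply/andP/eqP => [[_ /existsP[v /andP[/eqP Tv /eqP <-]]] | ->].
    by congr crow; apply: (is_tableauP _ tabT).1; rewrite Tu.
  split; first exact: max_entry_removable Tu.
  by apply/existsP; exists u; rewrite Tu !eqxx.
rewrite (exchange_big_dep (fun i : 'I_n.+1 => removable la i)) /=; last first.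
  by move=> T i _ /andP[].
apply: eq_bigr => i rem_i; have mu_part := decr_part_is_intpart la_part rem_i.
have sum_mu : sumn (decr_part la i) = n.
  by apply: succn_inj; rewrite -sumn_decr_part.
rewrite (num_SYT_tableau sum_mu) -(card_tableau_incr i _ mu_part) incr_decr_part //.
by rewrite -sum1_card; apply: eq_bigl => T; rewrite inE rem_i.
Qed.

Lemma num_SYT_nil : num_SYT [::] = 1.
Proof.
rewrite /num_SYT (eq_card (B := predT)) ?card_ffun ?card_ord ?card_cell // => T.
by rewrite !inE; apply/and3P; split; apply/forallP => -[[]].
Qed.

Local Open Scope ring_scope.

(** * Complete symmetric functions and Newton's identities *)

Section CompleteSymmetric.

Variable R : comNzRingType.
Implicit Types (B S : nat -> R) (X Y : seq R) (x y : R).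

Definition conv B S a : R := \sum_(k < a.+1) B k * S (a - k)%N.

(* Multiplication and division of \sum_a S a * t ^+ a by 1 - x * t. *)
Definition mul_linear x S a : R := S a - (if a is b.+1 then x * S b else 0).
Definition div_linear x S : nat -> R := conv (fun k => x ^+ k) S.

Lemma conv0 B S : conv B S 0 = B 0%N * S 0%N.
Proof. by rewrite /conv big_ord1. Qed.

Lemma eq_convr B S S' : S =1 S' -> conv B S =1 conv B S'.
Proof. by move=> eqS a; apply: eq_bigr => k _; rewrite eqS. Qed.

Lemma convDl B B' S a : conv (fun k => B k + B' k) S a = conv B S a + conv B' S a.
Proof. by rewrite /conv -big_split; apply: eq_bigr => k _; rewrite mulrDl. Qed.

Lemma convBl B B' S a : conv (fun k => B k - B' k) S a = conv B S a - conv B' S a.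
Proof. by rewrite /conv -sumrB; apply: eq_bigr => k _; rewrite mulrBl. Qed.

Lemma conv_exprS x S a : conv (fun k => x ^+ k.+1) S a = x * div_linear x S a.
Proof. by rewrite mulr_sumr; apply: eq_bigr => k _; rewrite exprS mulrA. Qed.

Lemma mul_linear0 x S : mul_linear x S 0 = S 0%N.
Proof. by rewrite /mul_linear subr0. Qed.

Lemma conv_mul_linear x B S : conv B (mul_linear x S) =1 mul_linear x (conv B S).
Proof.
case=> [|a]; first by rewrite mul_linear0 !conv0 mul_linear0.
rewrite /mul_linear /conv [LHS]big_ord_recr [X in _ = X - _]big_ord_recr /= subnn subr0.
rewrite [RHS]addrAC; congr (_ + _); rewrite mulr_sumr -sumrB; apply: eq_bigr => k _.
by rewrite (subSn (ltn_ord k : k <= a)%N) mulrBr mulrCA.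
Qed.

Lemma div_linear0 x S : div_linear x S 0 = S 0%N.
Proof. by rewrite /div_linear conv0 mul1r. Qed.

Lemma div_linearS x S a : div_linear x S a.+1 = S a.+1 + x * div_linear x S a.
Proof.
rewrite /div_linear /conv big_ord_recl subn0 mul1r mulr_sumr; congr (_ + _).
by apply: eq_bigr => k _; rewrite /= /bump /= add1n exprS mulrA subSS.
Qed.

Lemma div_linearK x S : mul_linear x (div_linear x S) =1 S.
Proof.
by case=> [|a]; rewrite ?mul_linear0 ?div_linear0 // /mul_linear div_linearS addrK.
Qed.

Lemma mul_linearK x S : div_linear x (mul_linear x S) =1 S.
Proof. by move=> a; rewrite /div_linear conv_mul_linear div_linearK. Qed.

(* The coefficient of t ^+ a in
   (\prod_(y <- Y) (1 - y * t)) / \prod_(x <- X) (1 - x * t). *)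
Definition complete_sym X Y : nat -> R :=
  foldr div_linear (foldr mul_linear (fun a => (a == 0)%N%:R) Y) X.

Lemma complete_sym0 X Y : complete_sym X Y 0 = 1.
Proof.
elim: X => [|x X IH]; last by rewrite /= div_linear0.
by elim: Y => [|y Y IH] //; rewrite /complete_sym /= mul_linear0.
Qed.

Lemma complete_sym_consl x X Y a :
  complete_sym (x :: X) Y a.+1 = complete_sym X Y a.+1 + x * complete_sym (x :: X) Y a.
Proof. exact: div_linearS. Qed.

Lemma complete_sym_consr X y Y :
  complete_sym X (y :: Y) =1 mul_linear y (complete_sym X Y).
Proof.
by elim: X => [|x X IH] a //=; rewrite /div_linear (eq_convr _ IH) conv_mul_linear.
Qed.

Definition newton_identities B S : Prop :=
  forall a, a.+1%:R * S a.+1 = conv B S a.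

Lemma newton_mul_linear x B S : newton_identities B S ->
  newton_identities (fun k => B k - x ^+ k.+1) (mul_linear x S).
Proof.
move=> newtonS a; rewrite convBl conv_exprS mul_linearK conv_mul_linear.
suff -> : mul_linear x (conv B S) a = a.+1%:R * S a.+1 - x * (a%:R * S a).
  by rewrite /mul_linear -natr1; ring.
by rewrite /mul_linear newtonS; case: a => [|a]; rewrite ?mul0r ?mulr0 ?newtonS.
Qed.

Lemma newton_div_linear x B S : newton_identities B S ->
  newton_identities (fun k => B k + x ^+ k.+1) (div_linear x S).
Proof.
move=> newtonS a; set B' := fun k => _; pose D := div_linear x S.
have convB' b : mul_linear x (conv B' D) b = b.+1%:R * S b.+1 + x * D b.
  by rewrite -conv_mul_linear (eq_convr _ (div_linearK _ _)) convDl conv_exprS newtonS.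
elim: a => [|a IH].
  by have := convB' 0%N; rewrite mul_linear0 div_linearS -/D => ->; ring.
have := convB' a.+1; rewrite {1}/mul_linear -IH => /(canRL (subrK _)) ->.
by rewrite [div_linear x S a.+2]div_linearS -[a.+2%:R]natr1 -/D; ring.
Qed.

Theorem complete_sym_newton X Y : newton_identities
  (fun k => \sum_(x <- X) x ^+ k.+1 - \sum_(y <- Y) y ^+ k.+1) (complete_sym X Y).
Proof.
have eq_newton B B' S : B =1 B' -> newton_identities B S -> newton_identities B' S.
  by move=> eqB newtonS a; rewrite newtonS; apply: eq_bigr => k _; rewrite eqB.
elim: X => [|x X /newton_div_linear-/(_ x)]; last first.
  by apply: eq_newton => k; rewrite big_cons; ring.
elim: Y => [|y Y /newton_mul_linear-/(_ y)]; last first.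
  by apply: eq_newton => k; rewrite big_cons; ring.
move=> a; rewrite mulr0 /conv big1 // => k _.
by rewrite !big_nil subrr mul0r.
Qed.

End CompleteSymmetric.

(** * Divided differences *)

Section DividedDifferences.

Variable F : fieldType.
Implicit Types (X Y : seq F) (g : F -> F) (x y : F).

Definition divdiff X g : F :=
  \sum_(x <- X) g x / \prod_(z <- X | z != x) (x - z).

Lemma eq_divdiff X g g' : g =1 g' -> divdiff X g = divdiff X g'.
Proof. by move=> eqg; apply: eq_bigr => x _; rewrite eqg. Qed.

Lemma perm_divdiff X X' g : perm_eq X X' -> divdiff X g = divdiff X' g.
Proof.
move=> eqX; rewrite /divdiff (perm_big _ eqX) /=; apply: eq_bigr => x _.
by rewrite (perm_big _ eqX).
Qed.

Lemma divdiffD X g g' :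
  divdiff X (fun z => g z + g' z) = divdiff X g + divdiff X g'.
Proof. by rewrite -big_split; apply: eq_bigr => z _; rewrite mulrDl. Qed.

Lemma divdiffZ X a g : divdiff X (fun z => a * g z) = a * divdiff X g.
Proof. by rewrite /divdiff mulr_sumr; apply: eq_bigr => z _; rewrite mulrA. Qed.

Lemma divdiff_cons_mulB x X g : uniq (x :: X) ->
  divdiff (x :: X) (fun z => (z - x) * g z) = divdiff X g.
Proof.
move=> /= /andP[xX uniqX]; rewrite /divdiff big_cons subrr mul0r mul0r add0r.
apply: eq_big_seq => z zX; have zx : z != x by apply: contraNneq xX => <-.
by rewrite big_cons eq_sym zx -mulf_div divff ?mul1r // subr_eq0.
Qed.

Lemma divdiff_cons x X g : x \notin X -> divdiff (x :: X) g
  = g x / \prod_(z <- X) (x - z)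
    + \sum_(z <- X) g z / ((z - x) * \prod_(y <- X | y != z) (z - y)).
Proof.
move=> xX; have ne_x z : z \in X -> z != x by move=> zX; apply: contraNneq xX => <-.
rewrite /divdiff !big_cons eqxx; congr (_ / _ + _).
  by rewrite big_seq_cond [RHS]big_seq; apply: eq_bigl => z; apply: andb_idr => /ne_x.
by apply: eq_big_seq => z /ne_x zx; rewrite big_cons eq_sym zx.
Qed.

Lemma divdiff_recursion x y X g : uniq (x :: y :: X) ->
  (x - y) * divdiff (x :: y :: X) g = divdiff (x :: X) g - divdiff (y :: X) g.
Proof.
move=> uniq_xy; have perm_xy : perm_eq (x :: y :: X) (y :: x :: X).
  by rewrite (perm_catCA [:: x] [:: y] X).
have uniq_yx : uniq (y :: x :: X) by rewrite -(perm_uniq perm_xy).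
rewrite -(divdiff_cons_mulB _ uniq_xy) -(divdiff_cons_mulB _ uniq_yx).
rewrite -(perm_divdiff _ perm_xy) -divdiffZ -[- divdiff _ _]mulN1r -divdiffZ -divdiffD.
by apply: eq_divdiff => z; ring.
Qed.

Lemma divdiff_const1 X : uniq X -> divdiff X (fun=> 1) = (size X == 1)%N%:R.
Proof.
case: X => [|x X]; first by rewrite /divdiff big_nil.
elim: X x => [|y X IH] x uniqX.
  by rewrite /divdiff big_seq1 big_cons eqxx big_nil divr1.
have xy : x - y != 0.
  by rewrite subr_eq0; case/andP: uniqX; rewrite inE negb_or => /andP[].
apply/eqP; rewrite -(mulrI_eq0 _ (mulfI xy)) divdiff_recursion // subr_eq0.
have uniq_yX := uniqX; move: uniqX; rewrite /= inE negb_or => /and3P[/andP[_ xX] yX uX].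
by rewrite !IH /= ?xX ?yX.
Qed.

Lemma divdiff_expr X a : uniq X -> divdiff X (fun z => z ^+ a)
  = if (size X <= a.+1)%N then complete_sym X [::] (a.+1 - size X) else 0.
Proof.
elim: X a => [|x X IH] a; first by rewrite /divdiff big_nil.
move=> uniqX; have uX : uniq X by case/andP: uniqX.
elim: a => [|a IHa].
  rewrite (@eq_divdiff _ _ (fun=> 1)) // divdiff_const1 // /= ltnS leqn0 subSS eqSS.
  by case: X {uniqX uX IH} => //=; rewrite div_linear0.
have -> : divdiff (x :: X) (fun z => z ^+ a.+1)
    = divdiff X (fun z => z ^+ a) + x * divdiff (x :: X) (fun z => z ^+ a).
  rewrite -(divdiff_cons_mulB _ uniqX) -divdiffZ -divdiffD.
  by apply: eq_divdiff => z /=; rewrite exprS mulrBl subrK.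
rewrite IHa IH // [size (x :: X)]/= !subSS [(_ < a.+2)%N]ltnS.
case: (ltngtP (size X) a.+1) => [ltX|_|->].
- by rewrite subSn // complete_sym_consl.
- by rewrite mulr0 addr0.
- by rewrite mulr0 addr0 subnn !complete_sym0.
Qed.

Theorem divdiff_complete_sym X Y a : uniq X ->
  divdiff X (fun z => z ^+ a * \prod_(y <- Y) (z - y))
  = if (size X <= (a + size Y).+1)%N
    then complete_sym X Y ((a + size Y).+1 - size X) else 0.
Proof.
move=> uniqX; elim: Y a => [|y Y IH] a.
  rewrite addn0 -divdiff_expr //; apply: eq_divdiff => z.
  by rewrite big_nil mulr1.
have -> : divdiff X (fun z => z ^+ a * \prod_(t <- y :: Y) (z - t))
    = divdiff X (fun z => z ^+ a.+1 * \prod_(t <- Y) (z - t))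
      + - y * divdiff X (fun z => z ^+ a * \prod_(t <- Y) (z - t)).
  rewrite -divdiffZ -divdiffD; apply: eq_divdiff => z.
  by rewrite big_cons exprS; ring.
rewrite !IH [size (y :: Y)]/= addSn addnS complete_sym_consr.
rewrite -[(size X <= (a + size Y).+1)%N]ltnS.
case: (ltngtP (size X) (a + size Y).+2) => [ltX|_|->].
- by rewrite subSn // mulNr.
- by rewrite mulr0 addr0.
- by rewrite mulr0 addr0 subnn mul_linear0.
Qed.

End DividedDifferences.

(** * Contents *)

Section Contents.

Variable R : nzRingType.
Implicit Types (la mu : seq nat) (V : zmodType).

(* The content of the cell that would be added at the end of row i. *)
Definition end_content la i : R := (nth 0%N la i)%:R - i%:R.

Fixpoint contents la : seq R :=
  if la is m :: mu then [seq j%:R | j <- iota 0 m] ++ [seq c - 1 | c <- contents mu]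
  else [::].

Lemma contents_cons m mu :
  contents (m :: mu) = [seq j%:R | j <- iota 0 m] ++ [seq c - 1 | c <- contents mu].
Proof. by []. Qed.

Lemma size_contents la : size (contents la) = sumn la.
Proof. by elim: la => //= m mu IH; rewrite size_cat !size_map size_iota IH. Qed.

Lemma end_content_consS m mu i : end_content (m :: mu) i.+1 = end_content mu i - 1.
Proof. by rewrite /end_content -natr1 opprD addrA. Qed.

Lemma end_content_incr la i j :
  end_content (incr_nth la i) j = end_content la j + (i == j)%:R.
Proof. by rewrite /end_content nth_incr_nth natrD addrAC addrC addrA addrAC. Qed.

Lemma end_content_decr la i : is_intpart la -> removable la i ->
  end_content (decr_part la i) i = end_content la i - 1.
Proof.
move=> la_part rem_i; rewrite -{2}(incr_decr_part la_part rem_i).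
by rewrite end_content_incr eqxx addrK.
Qed.

Lemma perm_contents_incr la i :
  perm_eq (contents (incr_nth la i)) (end_content la i :: contents la).
Proof.
elim: la i => [|m mu IH] [|i].
- by rewrite /end_content subrr.
- rewrite /end_content nth_nil sub0r -natr1 opprD /= (_ : contents _ = [:: - i%:R]) //.
  by elim: i => [|i /= ->] /=; rewrite ?oppr0 // -natr1 opprD.
- by rewrite !contents_cons -addn1 iotaD map_cat -catA perm_catCA /end_content subr0.
rewrite [incr_nth _ _]/= !contents_cons end_content_consS -[_ - 1 :: _]cat1s.
rewrite perm_sym perm_catCA perm_cat2l perm_sym.
exact: (perm_map (fun c => c - 1) (IH i)).
Qed.

Lemma sum_contents_incr V (phi : R -> V) la i :
  \sum_(c <- contents (incr_nth la i)) phi c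
  = \sum_(c <- contents la) phi c + phi (end_content la i).
Proof. by rewrite (perm_big _ (perm_contents_incr la i)) big_cons addrC. Qed.

Lemma sum_contents_cons V (phi : R -> V) m mu :
  \sum_(c <- contents (m :: mu)) phi c
  = \sum_(j <- iota 0 m) phi j%:R + \sum_(c <- contents mu) phi (c - 1).
Proof. by rewrite contents_cons big_cat !big_map. Qed.

Lemma telescope_sum_iota V (f : nat -> V) n :
  \sum_(j <- iota 0 n) (f j.+1 - f j) = f n - f 0%N.
Proof. by rewrite -{1}(subn0 n) telescope_sumr. Qed.

Lemma sum_end_content V (phi : R -> V) la N : (size la <= N)%N ->
  \sum_(i < N) phi (end_content la i)
  = \sum_(i < N) phi (- i%:R) + \sum_(c <- contents la) (phi (c + 1) - phi c).
Proof.
elim: la phi N => [|m mu IH] phi N.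
  move=> _; rewrite big_nil addr0; apply: eq_bigr => i _.
  by rewrite /end_content nth_nil sub0r.
case: N => // N /= le_N; rewrite !big_ord_recl sum_contents_cons oppr0 /=.
under eq_bigr do rewrite end_content_consS.
under [X in _ = _ + X + _]eq_bigr do rewrite /bump /= -natr1 opprD.
have -> : phi (end_content (m :: mu) 0)
    = phi 0 + \sum_(j <- iota 0 m) (phi (j%:R + 1) - phi j%:R).
  under eq_bigr do rewrite natr1.
  by rewrite (telescope_sum_iota (fun j => phi j%:R)) addrC subrK /end_content subr0.
rewrite (IH (fun c => phi (c - 1))) // addrACA; congr (_ + (_ + _)).
by apply: eq_bigr => c _; rewrite subrK addrK.
Qed.

End Contents.

Arguments end_content {R} la i.
Arguments contents {R} la.

(** * Frobenius formula *)

Section VandermondeProduct.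

Variable R : comNzRingType.

Fixpoint vandermonde (X : seq R) : R :=
  if X is x :: X' then \prod_(z <- X') (x - z) * vandermonde X' else 1.

Lemma vandermonde_cat_cons A x B :
  vandermonde (A ++ x :: B)
  = (-1) ^+ size A * \prod_(z <- A ++ B) (x - z) * vandermonde (A ++ B).
Proof.
elim: A => [|y A IH] /=; first by rewrite expr0 mul1r.
by rewrite IH !(big_cat, big_cons) exprS /=; ring.
Qed.

End VandermondeProduct.

Lemma prod_subr_eq0 (R : idomainType) (X : seq R) x :
  (\prod_(z <- X) (x - z) == 0) = (x \in X).
Proof.
rewrite prodf_seq_eq0 -has_pred1; apply: eq_has => z /=.
by rewrite subr_eq0 eq_sym.
Qed.

Lemma vandermonde_opp_iota (R : comNzRingType) s n :
  vandermonde [seq - (j%:R : R) | j <- iota s n] = (\prod_(j < n) j`!)%N%:R.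
Proof.
elim: n s => [|n IH] s; first by rewrite big_ord0.
rewrite /= IH big_ord_recr natrM mulrC /=; congr (_ * _).
rewrite fact_prod big_add1 natr_prod big_map -[s.+1]addn0 iotaDl big_map.
rewrite /index_iota subn0; apply: eq_bigr => j _.
by rewrite addSn -natr1 natrD; ring.
Qed.

Lemma bin2_natr (R : numFieldType) n : 'C(n, 2)%:R = n%:R * (n%:R - 1) / 2 :> R.
Proof.
have two_neq0 : 2 != 0 :> R by rewrite pnatr_eq0.
apply: (canRL (mulfK two_neq0)); rewrite -natrM (bin_ffact n 2) ffactnSr ffactn1 natrM.
by case: n => [|n]; rewrite ?mul0r // subn1 -natr1 addrK.
Qed.

Lemma iota_split n i : (i < n)%N -> iota 0 n = iota 0 i ++ i :: iota i.+1 (n - i.+1).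
Proof.
by move=> lt_in; rewrite -[i :: _]/(iota i _.+1) -iotaD subnSK // subnKC // ltnW.
Qed.

Section EndContents.

Variable N : nat.
Implicit Types (la : seq nat) (i : 'I_N).

Definition end_contents la : seq rat := [seq end_content la j | j <- iota 0 N].

Definition other_end_contents la (i : nat) : seq rat :=
  [seq end_content la j | j <- iota 0 N & j != i].

Lemma size_end_contents la : size (end_contents la) = N.
Proof. by rewrite size_map size_iota. Qed.

Lemma sum_end_contents (V : zmodType) (phi : rat -> V) la :
  \sum_(x <- end_contents la) phi x = \sum_(i < N) phi (end_content la i).
Proof. by rewrite big_map -{1}(subn0 N) big_mkord. Qed.

Lemma end_content_addn la i :
  end_content la i + N%:R = (nth 0 la i + (N - i))%N%:R :> rat.
Proof. by rewrite natrD natrB ?(ltnW (ltn_ord i)) // /end_content; ring. Qed.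

Lemma end_content_addn_neq0 la i : end_content la i + N%:R != 0 :> rat.
Proof. by rewrite end_content_addn pnatr_eq0; have := ltn_ord i; lia. Qed.

Lemma uniq_end_contents la : is_intpart la -> uniq (end_contents la).
Proof.
move=> la_part; rewrite map_inj_uniq ?iota_uniq //.
have decr j k : (j < k)%N -> end_content la k < end_content la j :> rat.
  move=> lt_jk; apply: ler_ltB; rewrite ?ltr_nat // ler_nat.
  exact: nth_intpart_leq (ltnW lt_jk).
move=> j k eq_jk; case: (ltngtP j k) => // /decr; by rewrite eq_jk ltxx.
Qed.

Lemma end_contents_split la i : exists A B,
  [/\ size A = i :> nat, end_contents la = A ++ end_content la i :: B
    & other_end_contents la i = A ++ B].
Proof.
exists [seq end_content la j | j <- iota 0 i].
exists [seq end_content la j | j <- iota i.+1 (N - i.+1)].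
rewrite size_map size_iota /end_contents /other_end_contents.
rewrite (iota_split (ltn_ord i)) -map_cat; split=> //; first by rewrite map_cat.
congr map; rewrite filter_cat /= eqxx; congr (_ ++ _); apply/all_filterP/allP => j.
  by rewrite mem_iota => /andP[_ lt_j]; rewrite ltn_eqF.
by rewrite mem_iota => /andP[lt_j _]; rewrite gtn_eqF.
Qed.

Lemma perm_end_contents la i :
  perm_eq (end_contents la) (end_content la i :: other_end_contents la i).
Proof.
have [A [B [_ -> ->]]] := end_contents_split la i.
by rewrite -cat1s perm_catCA.
Qed.

Lemma other_end_contents_incr la i :
  other_end_contents (incr_nth la i) i = other_end_contents la i.
Proof.
apply/eq_in_map => j; rewrite mem_filter => /andP[ji _].
by rewrite end_content_incr eq_sym (negPf ji) addr0.
Qed.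

Lemma vandermonde_end_contents la i : vandermonde (end_contents la)
  = (-1) ^+ i * \prod_(z <- other_end_contents la i) (end_content la i - z)
    * vandermonde (other_end_contents la i).
Proof.
have [A [B [<- -> ->]]] := end_contents_split la i.
exact: vandermonde_cat_cons.
Qed.

Lemma end_content_notin_others la i :
  is_intpart la -> end_content la i \notin other_end_contents la i.
Proof.
by move=> /uniq_end_contents; rewrite (perm_uniq (perm_end_contents la i)) => /andP[].
Qed.

Lemma prod_others_neq0 la i : is_intpart la ->
  \prod_(z <- other_end_contents la i) (end_content la i - z) != 0.
Proof. by move=> la_part; rewrite prod_subr_eq0 end_content_notin_others. Qed.

Lemma prod_end_contents_neq (f : rat -> rat) la i : is_intpart la ->
  \prod_(z <- end_contents la | z != end_content la i) f z
  = \prod_(z <- other_end_contents la i) f z.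
Proof.
move=> /end_content_notin_others x_notin.
rewrite (perm_big _ (perm_end_contents la i)) big_cons eqxx big_seq_cond [RHS]big_seq.
apply: eq_bigl => z; apply: andb_idr => zX.
by apply: contraNneq (x_notin i) => <-.
Qed.

Lemma prod_shift_end_contents t la i :
  \prod_(y <- [seq x + t | x <- end_contents la]) (end_content la i - y)
  = - t * \prod_(z <- other_end_contents la i) (end_content la i - t - z).
Proof.
rewrite big_map (perm_big _ (perm_end_contents la i)) big_cons.
by congr (_ * _); [ring | apply: eq_bigr => z _; ring].
Qed.

Lemma divdiff_end_contents g la : is_intpart la -> divdiff (end_contents la) g
  = \sum_(i < N) g (end_content la i)
      / \prod_(z <- other_end_contents la i) (end_content la i - z).
Proof.
move=> la_part; rewrite /divdiff sum_end_contents.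
by apply: eq_bigr => i _; rewrite prod_end_contents_neq.
Qed.

Lemma oppN_notin_end_contents la : - N%:R \notin end_contents la.
Proof.
apply/mapP => -[j]; rewrite mem_iota => /andP[_ lt_j] eq_j.
have /eqP[] := end_content_addn_neq0 la (Ordinal lt_j).
by rewrite /= -eq_j addNr.
Qed.

Lemma divdiff_cons_end_contents g la : is_intpart la -> g (- N%:R) = 0 ->
  divdiff (- N%:R :: end_contents la) g
  = \sum_(i < N) g (end_content la i) / ((end_content la i + N%:R)
      * \prod_(z <- other_end_contents la i) (end_content la i - z)).
Proof.
move=> la_part gN; rewrite divdiff_cons ?oppN_notin_end_contents // gN mul0r add0r.
rewrite sum_end_contents; apply: eq_bigr => i _.
by rewrite prod_end_contents_neq // opprK.
Qed.

(* Frobenius' form of the hook length formula: n! times the Vandermonde product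
   of the numbers la_i + N - i, over the product of their factorials. *)
Definition frobenius la : rat :=
  (sumn la)`!%:R * vandermonde (end_contents la)
  / (\prod_(j < N) (nth 0 la j + (N - j.+1))`!)%N%:R.

Lemma frobenius_incr la i :
  frobenius (incr_nth la i) * (end_content la i + N%:R)
    * \prod_(z <- other_end_contents la i) (end_content la i - z)
  = frobenius la * (sumn la).+1%:R
    * \prod_(z <- other_end_contents la i) (end_content la i + 1 - z).
Proof.
have denE : (\prod_(j < N) (nth 0 (incr_nth la i) j + (N - j.+1))`!
    = (nth 0 la i + (N - i)) * \prod_(j < N) (nth 0 la j + (N - j.+1))`!)%N.
  rewrite (bigD1 i) //= [in RHS](bigD1 i) //= mulnA; congr (_ * _)%N.
    by rewrite nth_incr_nth eqxx add1n addSn factS -addnS -subSn // subSS.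
  apply: eq_bigr => j; rewrite eq_sym -val_eqE => /negPf ji.
  by rewrite nth_incr_nth ji.
rewrite /frobenius denE sumn_incr_nth factS !natrM -end_content_addn.
rewrite !(vandermonde_end_contents _ i) other_end_contents_incr end_content_incr eqxx.
have x_neq0 := end_content_addn_neq0 la i.
have den_neq0 : (\prod_(j < N) (nth 0 la j + (N - j.+1))`!)%N%:R != 0 :> rat.
  by rewrite pnatr_eq0 -lt0n prodn_gt0 // => j; rewrite fact_gt0.
by rewrite /=; field; apply/andP.
Qed.

Lemma frobenius_incr_eq0 la i : is_intpart la -> ~~ is_intpart (incr_nth la i) ->
  frobenius (incr_nth la i) = 0.
Proof.
move=> la_part; rewrite is_intpart_incr // negb_or -leqNgt -lt0n => /andP[i_gt0 le_i].
apply/eqP; rewrite /frobenius mulf_eq0 mulf_eq0 (vandermonde_end_contents _ i).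
rewrite !mulf_eq0 prod_subr_eq0 other_end_contents_incr end_content_incr eqxx.
suff -> : end_content la i + 1 \in other_end_contents la i by rewrite !orbT.
have la_i : nth 0%N la i.-1 = nth 0%N la i.
  by apply/eqP; rewrite eqn_leq le_i nth_intpart_leq ?leq_pred.
apply/mapP; exists i.-1.
  by rewrite mem_filter mem_iota (leq_ltn_trans (leq_pred _)) // neq_ltn prednK ?leqnn.
have i_pred : i%:R = (i.-1)%:R + 1 :> rat by rewrite natr1 prednK.
by rewrite /end_content la_i i_pred; ring.
Qed.

Lemma frobenius_nil : frobenius [::] = 1.
Proof.
have numE : vandermonde (end_contents [::]) = (\prod_(j < N) j`!)%N%:R.
  rewrite -(vandermonde_opp_iota _ 0); congr vandermonde; apply: eq_map => j.
  by rewrite /end_content nth_nil sub0r.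
have denE : (\prod_(j < N) (nth 0 [::] j + (N - j.+1))`! = \prod_(j < N) j`!)%N.
  rewrite (reindex_inj rev_ord_inj) /=; apply: eq_bigr => j _; congr (_`!).
  by rewrite nth_nil; have := ltn_ord j; lia.
rewrite /frobenius numE denE mul1r divff // pnatr_eq0 -lt0n prodn_gt0 // => j.
exact: fact_gt0.
Qed.

Lemma sum_frobenius_incr la a : is_intpart la -> (size la < N)%N ->
  \sum_(i < N) frobenius (incr_nth la i) * end_content la i ^+ a
  = frobenius la * (sumn la).+1%:R
    * complete_sym (- N%:R :: end_contents la) [seq x - 1 | x <- end_contents la] a.
Proof.
move=> la_part lt_size; set Y := [seq _ | _ <- _].
have uniqX : uniq (- N%:R :: end_contents la).
  by rewrite /= oppN_notin_end_contents uniq_end_contents.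
have := divdiff_complete_sym Y a uniqX.
rewrite /= !size_map !size_iota ltnS leq_addl subSS addnK => <-.
rewrite divdiff_cons_end_contents //; last first.
  have /eqP -> : \prod_(y <- Y) (- N%:R - y) == 0 :> rat; last by rewrite mulr0.
  rewrite prod_subr_eq0; apply/mapP; exists (end_content la N.-1).
    by apply/map_f; rewrite mem_iota; lia.
  rewrite /end_content nth_default ?sub0r; last by lia.
  by rewrite -[in LHS](ltn_predK lt_size) -natr1 opprD.
rewrite mulr_sumr; apply: eq_bigr => i _.
rewrite prod_shift_end_contents; have := frobenius_incr la i.
rewrite opprK mul1r; move: (prod_others_neq0 i la_part) (end_content_addn_neq0 la i).
set b := _ + N%:R; set P := \prod_(z <- _) _; set Q := \prod_(z <- _) _.
move=> P_neq0 b_neq0 incrE.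
transitivity (frobenius (incr_nth la i) * b * P * end_content la i ^+ a / (b * P)).
  by field; apply/andP.
by rewrite incrE; field; apply/andP.
Qed.

Lemma sum_end_contents_id la : (size la <= N)%N ->
  \sum_(x <- end_contents la) x = (sumn la)%:R - 'C(N, 2)%:R.
Proof.
move=> le_size; rewrite sum_end_contents (sum_end_content id) // addrC.
congr (_ + _); last by rewrite -bin2_sum natr_sum -sumrN big_mkord.
under eq_bigr do rewrite addrAC subrr add0r.
by rewrite big_const_seq count_predT size_contents iter_addr_0.
Qed.

(* Removing the last cell of row i multiplies f_la by - 1 / |la| times the i-th
   term of the divided difference of this function. *)
Definition removal_numerator la (z : rat) : rat :=
  (z + N%:R - 1) * \prod_(y <- [seq x + 1 | x <- end_contents la]) (z - y).

Lemma divdiff_removal_numerator la : is_intpart la -> (size la <= N)%N ->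
  divdiff (end_contents la) (removal_numerator la) = - (sumn la)%:R.
Proof.
move=> la_part le_size; set X := end_contents la; pose Y := [seq x + 1 | x <- X].
have uniqX : uniq X by apply: uniq_end_contents.
have moment a : divdiff X (fun z => z ^+ a * \prod_(y <- Y) (z - y))
    = complete_sym X Y a.+1.
  rewrite divdiff_complete_sym // !size_map !size_iota.
  by rewrite -addSn leq_addl addnK.
rewrite (@eq_divdiff _ _ _ (fun z => z ^+ 1 * \prod_(y <- Y) (z - y)
  + (N%:R - 1) * (z ^+ 0 * \prod_(y <- Y) (z - y)))); last first.
  by move=> z; rewrite /removal_numerator; ring.
rewrite divdiffD divdiffZ !moment.
have newton1 := complete_sym_newton X Y 0; have newton2 := complete_sym_newton X Y 1.
move: newton1 newton2; rewrite /conv !big_ord_recr !big_ord0 /= complete_sym0.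
have power_sumB k : \sum_(x <- X) x ^+ k - \sum_(y <- Y) y ^+ k
    = \sum_(x <- X) (x ^+ k - (x + 1) ^+ k).
  by rewrite [X in _ - X]big_map sumrB.
have sumN1 : \sum_(x <- X) (-1) = - N%:R :> rat.
  by rewrite sumrN big_const_seq count_predT size_end_contents iter_addr_0.
have -> : \sum_(x <- X) x ^+ 1 - \sum_(y <- Y) y ^+ 1 = - N%:R.
  by rewrite power_sumB -sumN1; apply: eq_bigr => x _; ring.
have -> : \sum_(x <- X) x ^+ 2 - \sum_(y <- Y) y ^+ 2
    = - 2 * ((sumn la)%:R - 'C(N, 2)%:R) - N%:R.
  rewrite power_sumB -sum_end_contents_id // mulr_sumr -sumN1 -big_split /=.
  by apply: eq_bigr => x _; ring.
rewrite bin2_natr !add0r mul1r mulr1 => -> newton2.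
have two_neq0 : 2 != 0 :> rat by [].
by apply: (mulfI two_neq0); rewrite mulrDr newton2; field.
Qed.

Lemma frobenius_decr la i : is_intpart la -> removable la i ->
  frobenius (decr_part la i) * (sumn la)%:R
  = - frobenius la * (removal_numerator la (end_content la i)
      / \prod_(z <- other_end_contents la i) (end_content la i - z)).
Proof.
move=> la_part rem_i; have := frobenius_incr (decr_part la i) i.
have /esym othersE := other_end_contents_incr (decr_part la i) i.
rewrite -sumn_decr_part // end_content_decr // othersE incr_decr_part //.
rewrite /removal_numerator subrK prod_shift_end_contents mulN1r.
have := prod_others_neq0 i la_part.
set P := \prod_(z <- _) _; set Q := \prod_(z <- _) _ => P_neq0 decrE.
by apply: (mulIf P_neq0); rewrite -decrE; field.
Qed.

Lemma removal_numerator_eq0 la i : is_intpart la -> (size la <= N)%N ->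
  ~~ removable la i -> removal_numerator la (end_content la i) = 0.
Proof.
move=> la_part le_size; rewrite /removable -leqNgt => le_i; apply/eqP.
rewrite mulf_eq0 prod_subr_eq0; case: (ltnP i.+1 N) => [lt_i | le_N]; last first.
  have eq_N : N = i.+1 by apply/eqP; rewrite eqn_leq le_N ltn_ord.
  have la_i : nth 0%N la i = 0%N.
    by apply/eqP; rewrite -leqn0 (leq_trans le_i) // nth_default // -eq_N.
  have -> : N%:R = i%:R + 1 :> rat by rewrite natr1 -eq_N.
  by apply/orP; left; rewrite /end_content la_i; apply/eqP; ring.
apply/orP; right; apply/mapP; exists (end_content la i.+1).
  by apply/map_f; rewrite mem_iota.
have -> : end_content la i.+1 = end_content la i - 1 :> rat; last by rewrite subrK.
rewrite /end_content -natr1 (_ : nth 0%N la i.+1 = nth 0%N la i); first by ring.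
by apply/eqP; rewrite eqn_leq le_i nth_intpart_leq.
Qed.

Lemma sum_frobenius_decr la : is_intpart la -> (size la <= N)%N ->
  (\sum_(i < N | removable la i) frobenius (decr_part la i)) * (sumn la)%:R
  = frobenius la * (sumn la)%:R.
Proof.
move=> la_part le_size; rewrite mulr_suml.
rewrite (eq_bigr _ (fun i rem_i => frobenius_decr la_part rem_i)) -mulr_sumr.
rewrite mulNr -mulrN; congr (_ * _); apply: oppr_inj; rewrite opprK.
rewrite -divdiff_removal_numerator // divdiff_end_contents // big_mkcond /=.
apply: eq_bigr => i _.
by case: ifPn => // not_rem; rewrite removal_numerator_eq0 // mul0r.
Qed.

End EndContents.

Lemma big_ord_removable (V : nmodType) (la : seq nat) N (F : nat -> V) :
  (size la <= N)%N ->
  \sum_(i < N | removable la i) F i = \sum_(i < size la | removable la i) F i.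
Proof.
move=> le_size; rewrite (big_ord_widen_cond N (removable la) F le_size).
by apply: eq_bigl => i; apply/esym/andb_idr => /ltn_size_nth.
Qed.

Theorem num_SYT_frobenius N (la : seq nat) :
  is_intpart la -> (size la <= N)%N -> (num_SYT la)%:R = frobenius N la.
Proof.
move sum_la: (sumn la) => n; elim: n la sum_la => [|n IH] la sum_la la_part le_size.
  have -> : la = [::] by apply/nilP; rewrite /nilp -leqn0 -sum_la size_intpart_leq.
  by rewrite num_SYT_nil frobenius_nil.
rewrite (num_SYT_branching la_part sum_la) natr_sum.
pose F i : rat := (num_SYT (decr_part la i))%:R.
rewrite (@big_ord_removable _ la _ F) -1?sum_la ?size_intpart_leq //.
rewrite -(@big_ord_removable _ la N F) //.
apply: (@mulIf _ (sumn la)%:R); first by rewrite sum_la pnatr_eq0.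
rewrite -sum_frobenius_decr //; congr (_ * _); apply: eq_bigr => i rem_i.
rewrite /F IH ?decr_part_is_intpart //.
  by apply: succn_inj; rewrite -sumn_decr_part.
exact: leq_trans (size_decr_part la_part rem_i) le_size.
Qed.

(** * Finite differences *)

Section FiniteDifferences.

Variable R : comNzRingType.
Implicit Types (u v : nat -> R) (m : nat).

Fixpoint degree_lt m u : Prop :=
  if m is m'.+1 then degree_lt m' (fun n => u n.+1 - u n) else forall n, u n = 0.

Lemma eq_degree_lt m u v : u =1 v -> degree_lt m u -> degree_lt m v.
Proof.
elim: m u v => [|m IH] u v eq_uv /=; first by move=> u0 n; rewrite -eq_uv.
by apply: IH => n; rewrite !eq_uv.
Qed.

Lemma degree_ltB m u v :
  degree_lt m u -> degree_lt m v -> degree_lt m (fun n => u n - v n).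
Proof.
elim: m u v => [|m IH] u v /= deg_u deg_v; first by move=> n; rewrite deg_u deg_v subrr.
by apply: eq_degree_lt (IH _ _ deg_u deg_v) => n; ring.
Qed.

Lemma degree_ltZ m a u : degree_lt m u -> degree_lt m (fun n => a * u n).
Proof.
elim: m u => [|m IH] u /= deg_u; first by move=> n; rewrite deg_u mulr0.
by apply: eq_degree_lt (IH _ deg_u) => n; rewrite mulrBr.
Qed.

Lemma degree_lt_bin k : degree_lt k.+1 (fun n => 'C(n, k)%:R).
Proof.
elim: k => [|k IH]; first by move=> n; rewrite !bin0 subrr.
by apply: eq_degree_lt IH => n; rewrite binS natrD addrC addKr.
Qed.

Lemma degree_lt_eq0 m u :
  degree_lt m u -> (forall n, (n < m)%N -> u n = 0) -> forall n, u n = 0.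
Proof.
elim: m u => [|m IH] u //= deg_u u_eq0.
have diff_eq0 := IH _ deg_u _.
elim=> [|n IHn]; first exact: u_eq0.
apply/eqP; rewrite -IHn -subr_eq0; apply/eqP/diff_eq0 => k lt_k.
by rewrite !u_eq0 ?subrr // ltnW.
Qed.

Lemma degree_lt_interpolation m u : degree_lt m.+1 u ->
  (forall n, (n < m)%N -> u n = 0) -> forall n, u n = u m * 'C(n, m)%:R.
Proof.
move=> deg_u u_eq0 n; apply/eqP; rewrite -subr_eq0; apply/eqP; move: n.
apply: (@degree_lt_eq0 m.+1 (fun n => u n - u m * 'C(n, m)%:R)).
  by apply: degree_ltB => //; apply/degree_ltZ/degree_lt_bin.
move=> n; rewrite ltnS leq_eqVlt => /predU1P[->|lt_nm].
  by rewrite binn mulr1 subrr.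
by rewrite u_eq0 // bin_small // mulr0 subrr.
Qed.

Definition second_diff (g : R -> R) (x : R) : R := g (x + 1) + g (x - 1) - 2 * g x.

End FiniteDifferences.

Section DifferencesOfPolynomials.

Variable R : idomainType.
Implicit Types (p q : {poly R}).

Lemma forward_diff_horner p : exists2 q : {poly R},
  (size q <= (size p).-1)%N & forall x, p.[x + 1] - p.[x] = q.[x].
Proof.
have size_X1 : size ('X + 1%:P : {poly R}) = 2%N by rewrite size_XaddC.
exists (p \Po ('X + 1%:P) - p) => [|x]; last by rewrite !hornerE horner_comp !hornerE.
have size_comp : size (p \Po ('X + 1%:P)) = size p by apply: size_comp_poly2.
apply/leq_sizeP => j; rewrite coefB leq_eqVlt => /predU1P[<-|lt_j].
  rewrite -{1}size_comp -!lead_coefE lead_coef_comp ?size_X1 //.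
  by rewrite lead_coefXaddC expr1n mulr1 subrr.
by rewrite !nth_default ?subrr ?size_comp //; move: lt_j; case: size.
Qed.

Lemma second_diff_horner p : exists2 q : {poly R},
  (size q <= (size p).-2)%N & forall x, second_diff (horner p) x = q.[x].
Proof.
have [q size_q qE] := forward_diff_horner p.
have [s size_s sE] := forward_diff_horner q.
exists (s \Po ('X - 1%:P)) => [|x].
  by rewrite size_comp_poly2 ?size_XsubC // (leq_trans size_s) //; lia.
rewrite horner_comp !hornerE -sE -!qE /second_diff subrK; ring.
Qed.

End DifferencesOfPolynomials.

(** * Plancherel averages of polynomials in contents *)

Lemma big_intpart1 (V : nmodType) n (s : seq nat) (F : seq nat -> V) :
  \sum_(la : intpart n | val la == s) F la
  = if is_intpart s && (sumn s == n) then F s else 0.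
Proof.
case: ifPn => [s_part | not_part].
  by rewrite (big_pred1 (IntPart s_part)) // => la; rewrite -val_eqE.
rewrite big1 // => la /eqP eq_s; case/negP: not_part; rewrite -eq_s; exact: valP la.
Qed.

Lemma exchange_covers (V : nmodType) n (G : seq nat -> nat -> V) :
  \sum_(La : intpart n.+1) \sum_(i < n.+1 | removable La i) G (decr_part La i) i
  = \sum_(la : intpart n) \sum_(i < n.+1 | is_intpart (incr_nth la i)) G la i.
Proof.
transitivity (\sum_(La : intpart n.+1) \sum_(i < n.+1)
                \sum_(la : intpart n | incr_nth la i == La) G la i).
  apply: eq_bigr => La _; have La_part := intpart_is_intpart La.
  rewrite [LHS]big_mkcond; apply: eq_bigr => i _.
  case: ifPn => [rem_i|not_rem]; last first.
    rewrite big1 // => la /eqP eq_La; case/negP: not_rem.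
    by rewrite -eq_La removable_incr ?intpart_is_intpart.
  have mu_part := decr_part_is_intpart La_part rem_i.
  rewrite (eq_bigl (fun la : intpart n => val la == decr_part La i)) => [|la].
    rewrite (big_intpart1 n _ (G ^~ i)) mu_part -eqSS -sumn_decr_part //.
    by rewrite sumn_intpart eqxx.
  apply/eqP/eqP => [eq_La|->]; last exact: incr_decr_part.
  apply: (@incr_nth_intpart_inj i) => //; first exact: intpart_is_intpart.
  by rewrite eq_La incr_decr_part.
under [RHS]eq_bigr do rewrite big_mkcond; rewrite exchange_big [RHS]exchange_big /=.
apply: eq_bigr => i _; rewrite (exchange_big_dep xpredT) //=; apply: eq_bigr => la _.
rewrite (eq_bigl (fun La : intpart n.+1 => val La == incr_nth la i)) => [|La].
  by rewrite (big_intpart1 _ _ (fun=> G la i)) sumn_incr_nth sumn_intpart eqxx andbT.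
exact: eq_sym.
Qed.

(* Plancherel growth sends la to La with probability f_La / ((|la| + 1) f_la). *)
Definition growth_sum (phi : rat -> rat) (la : seq nat) : rat :=
  \sum_(i < (sumn la).+1 | is_intpart (incr_nth la i))
    (num_SYT (incr_nth la i))%:R * phi (end_content la i).

Definition growth_moment (la : seq nat) : nat -> rat :=
  let X := end_contents (sumn la).+1 la in
  complete_sym (- (sumn la).+1%:R :: X) [seq x - 1 | x <- X].

Lemma growth_moment0 la : growth_moment la 0 = 1.
Proof. exact: complete_sym0. Qed.

Lemma growth_sum_expr (la : seq nat) a : is_intpart la ->
  growth_sum (fun c => c ^+ a) la
  = (num_SYT la)%:R * (sumn la).+1%:R * growth_moment la a.
Proof.
move=> la_part; have size_la := size_intpart_leq la_part.
rewrite (@num_SYT_frobenius (sumn la).+1) ?leqW // -sum_frobenius_incr //.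
rewrite /growth_sum big_mkcond; apply: eq_bigr => i _; case: ifPn => [La_part|not_part].
  rewrite (@num_SYT_frobenius (sumn la).+1) //.
  by have := size_intpart_leq La_part; rewrite sumn_incr_nth.
by rewrite frobenius_incr_eq0 // mul0r.
Qed.

Lemma growth_moment_newton (la : seq nat) a : is_intpart la ->
  a.+1%:R * growth_moment la a.+1
  = \sum_(k < a.+1) (\sum_(c <- contents la) second_diff (fun x => x ^+ k.+1) c)
                    * growth_moment la (a - k).
Proof.
move=> la_part; rewrite /growth_moment complete_sym_newton /conv.
apply: eq_bigr => k _; congr (_ * _); set N := (sumn la).+1.
rewrite [X in _ - X]big_map big_cons -addrA -sumrB.
pose phi x : rat := x ^+ k.+1 - (x - 1) ^+ k.+1.
rewrite sum_end_contents (sum_end_content phi) /phi ?leqW ?size_intpart_leq //.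
have -> : \sum_(i < N) ((- i%:R) ^+ k.+1 - (- i%:R - 1) ^+ k.+1)
    = - (- N%:R) ^+ k.+1 :> rat.
  elim: N => [|n IH]; first by rewrite big_ord0 oppr0 expr0n oppr0.
  by rewrite big_ord_recr /= IH addKr -[n.+1%:R]natr1 opprD.
rewrite addNKr; apply: eq_bigr => c _.
by rewrite /second_diff addrK; ring.
Qed.

(* Polynomials in the power sums of the contents, of weight at most d when the
   a-th power sum has weight a + 2. *)
Inductive content_poly : nat -> (seq nat -> rat) -> Prop :=
| content_poly_const a : content_poly 0 (fun=> a)
| content_poly_power a : content_poly a.+2 (fun la => \sum_(c <- contents la) c ^+ a)
| content_polyD d F G : content_poly d F -> content_poly d G ->
    content_poly d (fun la => F la + G la)
| content_polyM d e F G : content_poly d F -> content_poly e G ->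
    content_poly (d + e) (fun la => F la * G la)
| content_polyW d e F : (d <= e)%N -> content_poly d F -> content_poly e F
| eq_content_poly d F G : (forall la, is_intpart la -> F la = G la) ->
    content_poly d F -> content_poly d G.

Lemma content_poly0 d : content_poly d (fun=> 0).
Proof. exact: content_polyW (leq0n _) (content_poly_const 0). Qed.

Lemma content_polyZ d a F : content_poly d F -> content_poly d (fun la => a * F la).
Proof. by rewrite -[d]add0n; apply: content_polyM; apply: content_poly_const. Qed.

Lemma content_poly_sum (I : Type) (r : seq I) d (F : I -> seq nat -> rat) :
  (forall i, content_poly d (F i)) -> content_poly d (fun la => \sum_(i <- r) F i la).
Proof.
move=> polyF; elim: r => [|i r IH].
  by apply: eq_content_poly (content_poly0 d) => la _; rewrite big_nil.
by apply: eq_content_poly (content_polyD (polyF i) IH) => la _; rewrite big_cons.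
Qed.

Lemma content_poly_horner (p : {poly rat}) :
  content_poly (size p).+1 (fun la => \sum_(c <- contents la) p.[c]).
Proof.
apply: (@eq_content_poly _
  (fun la => \sum_(i < size p) p`_i * \sum_(c <- contents la) c ^+ i)).
  move=> la _; under [RHS]eq_bigr do rewrite horner_coef.
  by rewrite exchange_big; apply: eq_bigr => i _; rewrite mulr_sumr.
apply: content_poly_sum => i; apply: content_polyZ.
by apply: content_polyW (content_poly_power i); apply: ltn_ord.
Qed.

Lemma content_poly_growth_moment a : content_poly a (growth_moment ^~ a).
Proof.
elim/ltn_ind: a => -[|a] IH.
  by apply: eq_content_poly (content_poly_const 1) => la _; rewrite growth_moment0.
apply: (@eq_content_poly _ (fun la => a.+1%:R^-1 * \sum_(k < a.+1)
    (\sum_(c <- contents la) second_diff (fun x => x ^+ k.+1) c)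
    * growth_moment la (a - k))) => [la la_part|].
  by rewrite -growth_moment_newton // mulKf // pnatr_eq0.
apply/content_polyZ/content_poly_sum => k; have le_k : (k <= a)%N by rewrite -ltnS.
apply: (@content_polyW (k.+1 + (a - k))); first by rewrite addSn subnKC.
apply: content_polyM; last first.
  by apply: IH; rewrite ltnS leq_subr.
have [q size_q qE] := @second_diff_horner rat 'X^(k.+1).
have poly_q : content_poly k.+1 (fun la => \sum_(c <- contents la) q.[c]).
  by apply: content_polyW (content_poly_horner q); move: size_q; rewrite size_polyXn.
apply: eq_content_poly poly_q => la _; apply: eq_bigr => c _.
by rewrite -qE /second_diff !hornerXn.
Qed.

(* Polynomials in the power sums and in a content c of weight 1, of weight at
   most d - 2; in particular zero when d < 2. *)
Inductive content_incr (d : nat) : (seq nat -> rat -> rat) -> Prop :=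
| content_incr0 : content_incr d (fun _ _ => 0)
| content_incr_monomial k e G : content_poly e G -> (k + e + 2 <= d)%N ->
    content_incr d (fun la c => c ^+ k * G la)
| content_incrD D D' : content_incr d D -> content_incr d D' ->
    content_incr d (fun la c => D la c + D' la c)
| eq_content_incr D D' : (forall la c, is_intpart la -> D la c = D' la c) ->
    content_incr d D -> content_incr d D'.

Lemma content_incrW d e D : (d <= e)%N -> content_incr d D -> content_incr e D.
Proof.
move=> le_de; elim=> [|k f G polyG le_d|D1 D2 _ incr1 _ incr2|D1 D2 eqD _ incr1].
- exact: content_incr0.
- exact: content_incr_monomial polyG (leq_trans le_d le_de).
- exact: content_incrD.
- exact: eq_content_incr eqD incr1.
Qed.

Lemma content_incr_lt2 d D la c :
  (d < 2)%N -> content_incr d D -> is_intpart la -> D la c = 0.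
Proof.
move=> d_lt2 incr_D la_part.
elim: incr_D => [//|k e G _ le_d|D1 D2 _ D1_0 _ D2_0|D1 D2 eqD _ D1_0].
- by exfalso; lia.
- by rewrite D1_0 D2_0 addr0.
- by rewrite -eqD.
Qed.

Lemma content_incr_mulr d e D' :
  (forall k f G, content_poly f G -> (k + f + 2 <= d)%N ->
     content_incr e (fun la c => c ^+ k * G la * D' la c)) ->
  forall D, content_incr d D -> content_incr e (fun la c => D la c * D' la c).
Proof.
move=> mul_D' D; elim=> [|k f G|D1 D2 _ incr1 _ incr2|D1 D2 eqD _ incr1].
- by apply: eq_content_incr (content_incr0 _) => la c _; rewrite mul0r.
- exact: mul_D'.
- by apply: eq_content_incr (content_incrD incr1 incr2) => la c _; rewrite mulrDl.
- by apply: eq_content_incr incr1 => la c /eqD->.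
Qed.

Lemma content_incr_mull d e F D : content_poly e F -> content_incr d D ->
  content_incr (e + d) (fun la c => F la * D la c).
Proof.
move=> polyF incr_D; apply: (@eq_content_incr _ (fun la c => D la c * F la)).
  by move=> la c _; rewrite mulrC.
apply: (content_incr_mulr (D' := fun la _ => F la)) incr_D => k f G polyG le_d.
apply: (@eq_content_incr _ (fun la c => c ^+ k * (G la * F la))).
  by move=> la c _; rewrite mulrA.
by apply: content_incr_monomial (content_polyM polyG polyF) _; lia.
Qed.

Lemma content_incrM d e D D' : content_incr d D -> content_incr e D' ->
  content_incr (d + e) (fun la c => D la c * D' la c).
Proof.
move=> incr_D incr_D'; apply: content_incr_mulr incr_D => k f G polyG le_d.
apply: (@eq_content_incr _ (fun la c => D' la c * (c ^+ k * G la))).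
  by move=> la c _; rewrite mulrC.
apply: (content_incr_mulr (D' := fun la c => c ^+ k * G la)) incr_D'.
move=> j h G' polyG' le_e.
apply: (@eq_content_incr _ (fun la c => c ^+ (j + k) * (G' la * G la))).
  by move=> la c _; rewrite exprD mulrACA.
by apply: content_incr_monomial (content_polyM polyG' polyG) _; lia.
Qed.

Lemma content_poly_incr d F : content_poly d F -> exists2 D, content_incr d D &
  forall la i, is_intpart la -> is_intpart (incr_nth la i) ->
    F (incr_nth la i) = F la + D la (end_content la i).
Proof.
elim=> {d F} [a|a|d F G _ [D incr_D DE] _ [D' incr_D' D'E]
  |d e F G polyF [D incr_D DE] polyG [D' incr_D' D'E]|d e F le_de _ [D incr_D DE]
  |d F G eqF _ [D incr_D DE]].
- by exists (fun _ _ => 0); [apply: content_incr0 | move=> *; rewrite addr0].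
- exists (fun la c => c ^+ a * 1) => [|la i _ _].
    by apply: content_incr_monomial (content_poly_const 1) _; lia.
  by rewrite sum_contents_incr mulr1.
- exists (fun la c => D la c + D' la c) => [|la i la_part La_part].
    exact: content_incrD.
  by rewrite DE // D'E // addrACA.
- exists (fun la c => F la * D' la c + (G la * D la c + D la c * D' la c)).
    apply: content_incrD; first exact: content_incr_mull.
    apply: content_incrD; last exact: content_incrM.
    by rewrite addnC; apply: content_incr_mull.
  by move=> la i la_part La_part; rewrite DE // D'E //; ring.
- by exists D => //; apply: content_incrW incr_D.
- by exists D => // la i la_part La_part; rewrite -!eqF // DE.
Qed.

Lemma growth_sumD (phi psi : rat -> rat) la :
  growth_sum (fun c => phi c + psi c) la = growth_sum phi la + growth_sum psi la.
Proof. by rewrite -big_split; apply: eq_bigr => i _; rewrite mulrDr. Qed.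

Lemma growth_sumZ (phi : rat -> rat) a la :
  growth_sum (fun c => phi c * a) la = growth_sum phi la * a.
Proof. by rewrite /growth_sum mulr_suml; apply: eq_bigr => i _; rewrite mulrA. Qed.

Lemma content_incr_growth d D : content_incr d D ->
  exists2 G, content_poly (d - 2) G & forall la, is_intpart la ->
    growth_sum (D la) la = (num_SYT la)%:R * (sumn la).+1%:R * G la.
Proof.
elim=> [|k e G polyG le_d|D1 D2 _ [G1 poly1 G1E] _ [G2 poly2 G2E]
  |D1 D2 eqD _ [G polyG GE]].
- exists (fun=> 0) => [|la _]; first exact: content_poly0.
  by rewrite mulr0 /growth_sum big1 // => i _; rewrite mulr0.
- exists (fun la => growth_moment la k * G la) => [|la la_part].
    by apply: content_polyW (content_polyM (content_poly_growth_moment k) polyG); lia.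
  by rewrite growth_sumZ growth_sum_expr // mulrA.
- exists (fun la => G1 la + G2 la) => [|la la_part]; first exact: content_polyD.
  by rewrite growth_sumD G1E // G2E // mulrDr.
- exists G => // la la_part; rewrite -GE //.
  by apply: eq_bigr => i _; rewrite eqD.
Qed.

Definition plancherel_mean (F : seq nat -> rat) (n : nat) : rat :=
  (n`!)%:R^-1 * \sum_(la : intpart n) (num_SYT la)%:R ^+ 2 * F la.

Lemma sum_num_SYT_cover n (F : seq nat -> rat) :
  \sum_(La : intpart n.+1) (num_SYT La)%:R ^+ 2 * F La
  = \sum_(la : intpart n) (num_SYT la)%:R
      * \sum_(i < n.+1 | is_intpart (incr_nth la i))
          (num_SYT (incr_nth la i))%:R * F (incr_nth la i).
Proof.
pose G la i := (num_SYT la)%:R * ((num_SYT (incr_nth la i))%:R * F (incr_nth la i)).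
transitivity (\sum_(La : intpart n.+1) \sum_(i < n.+1 | removable La i)
                G (decr_part La i) i).
  apply: eq_bigr => La _; have La_part := intpart_is_intpart La.
  rewrite expr2 {1}(num_SYT_branching La_part (sumn_intpart La)) natr_sum.
  rewrite -mulrA mulr_suml.
  by apply: eq_bigr => i rem_i; rewrite /G incr_decr_part.
by rewrite exchange_covers; apply: eq_bigr => la _; rewrite mulr_sumr.
Qed.

Lemma plancherel_mean_growth n (F : seq nat -> rat) (D : seq nat -> rat -> rat) :
  (forall la, is_intpart la ->
     growth_sum (D la) la = (num_SYT la)%:R * (sumn la).+1%:R * F la) ->
  (n.+1)`!%:R^-1 * \sum_(la : intpart n) (num_SYT la)%:R * growth_sum (D la) la
  = plancherel_mean F n.
Proof.
move=> FE; have n1_neq0 : n.+1%:R != 0 :> rat by rewrite pnatr_eq0.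
rewrite factS natrM invfM -[LHS]mulrA [LHS]mulrCA; congr (_ * _).
apply: (canLR (mulKf n1_neq0)); rewrite mulr_sumr; apply: eq_bigr => la _.
by rewrite FE ?intpart_is_intpart // sumn_intpart expr2; ring.
Qed.

Lemma plancherel_meanS n (F : seq nat -> rat) (D : seq nat -> rat -> rat) :
  (forall la i, is_intpart la -> is_intpart (incr_nth la i) ->
     F (incr_nth la i) = F la + D la (end_content la i)) ->
  plancherel_mean F n.+1 = plancherel_mean F n
    + (n.+1)`!%:R^-1 * \sum_(la : intpart n) (num_SYT la)%:R * growth_sum (D la) la.
Proof.
move=> DE.
rewrite -(@plancherel_mean_growth n F (fun la c => c ^+ 0 * F la)); last first.
  by move=> la la_part; rewrite growth_sumZ growth_sum_expr // growth_moment0 mulr1.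
rewrite -mulrDr -big_split /plancherel_mean sum_num_SYT_cover /=; congr (_ * _).
apply: eq_bigr => la _; have la_part := intpart_is_intpart la.
rewrite -mulrDr -growth_sumD /growth_sum sumn_intpart; congr (_ * _).
by apply: eq_bigr => i La_part; rewrite DE // expr0 mul1r.
Qed.

Theorem plancherel_mean_degree d F :
  content_poly d F -> degree_lt (d./2).+1 (plancherel_mean F).
Proof.
elim/ltn_ind: d F => d IH F polyF; have [D incr_D DE] := content_poly_incr polyF.
have meanS n := plancherel_meanS n DE.
case: (ltnP d 2) => [d_lt2 | d_ge2].
  have -> : d./2 = 0%N by case: d d_lt2 {IH polyF incr_D} => [|[]].
  move=> n; rewrite meanS addrC addKr big1 ?mulr0 // => la _.
  rewrite /growth_sum big1 ?mulr0 // => i _.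
  by rewrite (content_incr_lt2 _ d_lt2 incr_D) ?mulr0 // intpart_is_intpart.
have [G polyG GE] := content_incr_growth incr_D.
have -> : d./2 = ((d - 2)./2).+1 by lia.
apply: eq_degree_lt (IH (d - 2)%N _ G polyG); last by lia.
by move=> n; rewrite meanS addrC addKr (plancherel_mean_growth _ GE).
Qed.

(** * Hook lengths and contents *)

Lemma conj_part_rcons (mu : seq nat) x j :
  conj_part (rcons mu x) j = (conj_part mu j + (j < x))%N.
Proof. by rewrite /conj_part -cats1 count_cat /= addn0. Qed.

Lemma conj_part_small (mu : seq nat) x j :
  all (leq x) mu -> (j < x)%N -> conj_part mu j = size mu.
Proof.
move=> le_mu lt_j; apply/eqP; rewrite -all_count; apply: sub_all le_mu => y.
exact: leq_trans.
Qed.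

(* The hook lengths of a first row of length m over mu complement the numbers
   m + k - mu_k in {1, ..., m + size mu}. *)
Lemma sum_first_row_hooks (V : zmodType) (g : nat -> V) m (mu : seq nat) :
  sorted geq mu -> all (geq m) mu ->
  \sum_(j < m) g (m - j + conj_part mu j)%N
    + \sum_(k < size mu) g (m + k.+1 - nth 0 mu k)%N
  = \sum_(t < m + size mu) g t.+1.
Proof.
have geq_trans : transitive geq by move=> a b c /= le_ba le_cb; apply: leq_trans le_ba.
elim/last_ind: mu => [_ _|mu x IH].
  rewrite big_ord0 addr0 /= addn0 (reindex_inj rev_ord_inj) /=.
  by apply: eq_bigr => j _; congr g; have := ltn_ord j; lia.
rewrite (sorted_pairwise geq_trans) pairwise_rcons -(sorted_pairwise geq_trans).
rewrite all_rcons => /andP[mu_ge mu_sorted] /andP[/= le_xm le_mu].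
rewrite size_rcons addnS !big_ord_recr /= -IH // nth_rcons ltnn eqxx.
have -> : \sum_(k < size mu) g (m + k.+1 - nth 0 (rcons mu x) k)%N
    = \sum_(k < size mu) g (m + k.+1 - nth 0 mu k)%N.
  by apply: eq_bigr => k _; rewrite nth_rcons ltn_ord.
pose f j := g ((m + size mu).+1 - j)%N.
suff addE : \sum_(j < m) g (m - j + conj_part (rcons mu x) j)%N
    = \sum_(j < m) g (m - j + conj_part mu j)%N + (f 0%N - f x).
  by rewrite addE addrACA addnS subrK /f subn0.
have -> : f 0%N - f x = \sum_(j < m) (if (j < x)%N then f j - f j.+1 else 0).
  rewrite -big_mkcond /= -(big_ord_widen m (fun j => f j - f j.+1) le_xm) -opprB.
  rewrite -(telescope_sumr _ (leq0n x)) big_mkord -sumrN.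
  by apply: eq_bigr => j _; rewrite opprB.
rewrite -big_split; apply: eq_bigr => j _; rewrite conj_part_rcons /=.
case: ifP => [lt_jx|_]; last by rewrite addn0 addr0.
rewrite (conj_part_small mu_ge lt_jx) /f; have lt_jm := ltn_ord j.
have -> : (m - j + size mu = (m + size mu).+1 - j.+1)%N by lia.
by rewrite addrC subrK; congr g; lia.
Qed.

Section HookContent.

Variable R : comNzRingType.
Implicit Types (g phi : R -> R) (mu : seq nat).

Definition hook_sum g la : R := \sum_(u : cell la) g (hook_length u)%:R.

Lemma hook_sumE g la : hook_sum g la = \sum_(i < size la) \sum_(j < nth 0%N la i)
  g ((nth 0 la i - j.+1) + (conj_part la j - i.+1) + 1)%N%:R.
Proof. by rewrite sig_big_dep. Qed.

Lemma hook_sum_cons g m mu : all (geq m) mu ->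
  hook_sum g (m :: mu)
  = \sum_(j < m) g (m - j + conj_part mu j)%N%:R + hook_sum g mu.
Proof.
move=> /allP le_mu; rewrite !hook_sumE /= big_ord_recl /=; congr (_ + _).
  apply: eq_bigr => j _; congr (g _%:R); rewrite /conj_part /= ltn_ord.
  by have := ltn_ord j; lia.
apply: eq_bigr => i _; apply: eq_bigr => j _; congr (g (_ + _ + _)%:R).
have /le_mu/= le_i : nth 0%N mu i \in mu by apply: mem_nth.
by rewrite /bump /conj_part /= (leq_trans (ltn_ord j) le_i).
Qed.

Lemma hook_sum_cons_contents g m mu : sorted geq (m :: mu) ->
  hook_sum g (m :: mu) = hook_sum g mu + \sum_(t <- iota 0 m) g t.+1%:R
    + \sum_(c <- contents mu) (g (m%:R - c + 1) - g (m%:R - c)).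
Proof.
move=> m_mu_sorted; have mu_sorted := path_sorted m_mu_sorted.
have le_mu : all (geq m) mu.
  by apply: order_path_min m_mu_sorted => a b c /= le_ba le_cb; apply: leq_trans le_ba.
rewrite hook_sum_cons // addrC -addrA; congr (_ + _).
have := sum_first_row_hooks (fun n => g n%:R) mu_sorted le_mu.
rewrite big_split_ord /= => /(canRL (addrK _)) ->.
have sum_iota f : \sum_(t <- iota 0 m) f t = \sum_(t < m) f t :> R.
  by rewrite -{1}(subn0 m) big_mkord.
rewrite sum_iota -addrA; congr (_ + _).
have -> : \sum_(k < size mu) g (m + k.+1 - nth 0 mu k)%N%:R
    = \sum_(k < size mu) g (m%:R - end_content mu k + 1).
  apply: eq_bigr => k _; have le_k : (nth 0 mu k <= m)%N.
    by apply/(allP le_mu)/mem_nth.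
  rewrite natrB ?(leq_trans le_k) ?leq_addr // natrD -natr1 /end_content.
  by congr g; ring.
rewrite (sum_end_content (fun x => g (m%:R - x + 1))) // opprD addrA -sumrB.
rewrite big1 => [|k _]; last by rewrite opprK -natrD natr1 subrr.
rewrite add0r -sumrN; apply: eq_bigr => c _; rewrite opprB; congr (_ - g _).
by ring.
Qed.

Lemma sum_second_diff g c n :
  \sum_(j <- iota 0 n) second_diff g (j%:R - c)
  = g (n%:R - c) - g (n%:R - c - 1) - (g (- c) - g (- c - 1)).
Proof.
pose f j := g (j%:R - c) - g (j%:R - c - 1).
have -> : g (- c) - g (- c - 1) = f 0%N by rewrite /f sub0r.
rewrite -(telescope_sum_iota f) /f; apply: eq_bigr => j _.
rewrite /second_diff -[j.+1%:R]natr1 (_ : j%:R + 1 - c = j%:R - c + 1); last by ring.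
by rewrite addrK; ring.
Qed.

Definition content_diff_sum phi la : R :=
  \sum_(x <- contents la) \sum_(y <- contents la) phi (x - y).

Definition even_function g : Prop := forall x, g (- x) = g x.

Lemma even_second_diff g : even_function g -> even_function (second_diff g).
Proof.
move=> even_g x; have oppB : - x + 1 = - (x - 1) by ring.
have oppD : - x - 1 = - (x + 1) by ring.
by rewrite /second_diff oppB oppD !even_g [g (x - 1) + _]addrC.
Qed.

Lemma content_diff_sum_cons phi m mu : even_function phi ->
  content_diff_sum phi (m :: mu)
  = \sum_(i <- iota 0 m) \sum_(j <- iota 0 m) phi (j%:R - i%:R)
    + 2 * (\sum_(c <- contents mu) \sum_(j <- iota 0 m) phi (j%:R - (c - 1)))
    + content_diff_sum phi mu.
Proof.
move=> even_phi; rewrite /content_diff_sum sum_contents_cons.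
under eq_bigr do rewrite sum_contents_cons.
under [X in _ + X = _]eq_bigr do rewrite sum_contents_cons.
rewrite !big_split /= [X in (_ + X) + _ = _]exchange_big /=.
have -> : \sum_(c <- contents mu) \sum_(j <- iota 0 m) phi (c - 1 - j%:R)
    = \sum_(c <- contents mu) \sum_(j <- iota 0 m) phi (j%:R - (c - 1)).
  by apply: eq_bigr => c _; apply: eq_bigr => j _; rewrite -even_phi opprB.
under [X in _ + (_ + X)]eq_bigr do
  under eq_bigr => y _ do rewrite opprB addrA subrK.
rewrite exchange_big /=; ring.
Qed.

Lemma sum_square_second_diff g m : even_function g ->
  \sum_(i <- iota 0 m) \sum_(j <- iota 0 m) second_diff g (j%:R - i%:R)
  = 2 * (g m%:R - g 0).
Proof.
move=> even_g.
have -> : 2 * (g m%:R - g 0) = (g m%:R - g 0) - (g (m%:R - m%:R) - g (m%:R - 0)).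
  by rewrite subrr subr0; ring.
rewrite -(telescope_sum_iota (fun i => g i%:R)).
rewrite -(telescope_sum_iota (fun i => g (m%:R - i%:R))).
rewrite -sumrB; apply: eq_bigr => i _; rewrite sum_second_diff !even_g.
have oppS : - i%:R - 1 = - i.+1%:R :> R by rewrite -natr1; ring.
have subS : m%:R - i%:R - 1 = m%:R - i.+1%:R :> R by rewrite -natr1; ring.
by rewrite oppS subS even_g; ring.
Qed.

Theorem hook_sum_contents g la : even_function g -> is_intpart la ->
  2 * hook_sum g la
  = 2 * (\sum_(c <- contents la) g c) + content_diff_sum (second_diff g) la.
Proof.
move=> even_g /andP[la_sorted _]; elim: la la_sorted => [|m mu IH] m_mu_sorted.
  by rewrite hook_sumE /content_diff_sum !big_nil big_ord0 !mulr0 addr0.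
rewrite hook_sum_cons_contents // content_diff_sum_cons; last exact: even_second_diff.
rewrite sum_square_second_diff // sum_contents_cons.
rewrite 2!mulrDr (IH (path_sorted m_mu_sorted)).
have -> : \sum_(t <- iota 0 m) g t.+1%:R
    = \sum_(t <- iota 0 m) g t%:R + (g m%:R - g 0).
  by rewrite -(telescope_sum_iota (fun t => g t%:R)) sumrB addrC subrK.
have -> : \sum_(c <- contents mu) \sum_(j <- iota 0 m) second_diff g (j%:R - (c - 1))
    = \sum_(c <- contents mu) (g (m%:R - c + 1) - g (m%:R - c))
      - \sum_(c <- contents mu) g (c - 1) + \sum_(c <- contents mu) g c.
  rewrite -sumrB -big_split; apply: eq_bigr => c _; rewrite sum_second_diff /=.
  have -> : m%:R - (c - 1) = m%:R - c + 1 by ring.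
  have -> : - (c - 1) - 1 = - c by ring.
  by rewrite addrK !even_g; ring.
by ring.
Qed.

End HookContent.

Arguments hook_sum {R} g la.

Lemma content_poly_diff_power j :
  content_poly j.+4 (content_diff_sum (fun x => x ^+ j)).
Proof.
apply: (@eq_content_poly _ (fun la => \sum_(i < j.+1) ((-1) ^+ i * 'C(j, i)%:R)
  * ((\sum_(x <- contents la) x ^+ (j - i)) * \sum_(y <- contents la) y ^+ i))).
  move=> la _; rewrite /content_diff_sum; under [RHS]eq_bigr => x _.
    under eq_bigr do rewrite exprBn.
    rewrite exchange_big /=.
    over.
  rewrite [RHS]exchange_big; apply: eq_bigr => i _ /=.
  rewrite mulr_suml mulr_sumr; apply: eq_bigr => x _.
  rewrite !mulr_sumr; apply: eq_bigr => y _.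
  by rewrite -[RHS]mulr_natr; ring.
apply: content_poly_sum => i; apply: content_polyZ.
apply: (@content_polyW ((j - i).+2 + i.+2)); first by have := ltn_ord i; lia.
by apply: content_polyM; apply: content_poly_power.
Qed.

Theorem content_poly_hook_sum (p : {poly rat}) : even_function (horner p) ->
  content_poly (size p).+1 (hook_sum (horner p)).
Proof.
move=> even_p; have [q size_q qE] := second_diff_horner p.
apply: (@eq_content_poly _ (fun la => \sum_(c <- contents la) p.[c]
    + 2^-1 * \sum_(j < size q) q`_j * content_diff_sum (fun x => x ^+ j) la)).
  move=> la la_part; apply: (@mulfI _ 2) => //.
  rewrite hook_sum_contents // mulrDr mulVKf //; congr (_ + _).
  rewrite /content_diff_sum; under [RHS]eq_bigr => x _ do
    under eq_bigr => y _ do rewrite qE horner_coef.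
  under [LHS]eq_bigr do rewrite mulr_sumr.
  rewrite [LHS]exchange_big; apply: eq_bigr => x _ /=.
  by under [LHS]eq_bigr do rewrite mulr_sumr; rewrite [LHS]exchange_big.
apply: content_polyD; first exact: content_poly_horner.
apply/content_polyZ/content_poly_sum => j; apply: content_polyZ.
apply: content_polyW (content_poly_diff_power j).
have := leq_trans (ltn_ord j) size_q; case: (size p) => [|[|n]] /=; lia.
Qed.

(** * Hook shapes *)

Lemma hook_length_leq (la : seq nat) (u : cell la) : is_intpart la ->
  (hook_length u + crow u + ccol u <= sumn la)%N.
Proof.
move=> /andP[_ la_pos]; have := nth_size_leq_sumn la_pos (crow_lt u).
have := ccol_lt u; have := crow_lt u; have := count_size (ltn (ccol u)) la.
by rewrite /hook_length /conj_part; lia.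
Qed.

Lemma hook_length_corner (la : seq nat) (u : cell la) : is_intpart la ->
  crow u = 0%N -> ccol u = 0%N -> (hook_length u).+1 = (nth 0 la 0 + size la)%N.
Proof.
move=> /andP[_ la_pos] row_u col_u; have := crow_lt u; have := ccol_lt u.
rewrite /hook_length row_u col_u (@conj_part_small _ 1) //; first by lia.
by apply/allP => p p_la; rewrite lt0n; apply: contraNneq la_pos => <-.
Qed.

Lemma hook_sum_corner (R : comNzRingType) r (g : R -> R) (la : seq nat) :
  is_intpart la -> sumn la = r.+1 -> (forall h, (0 < h <= r)%N -> g h%:R = 0) ->
  hook_sum g la = if (nth 0 la 0 + size la == r.+2)%N then g r.+1%:R else 0.
Proof.
move=> la_part sum_la g0.
have lt_corner : (0 < nth 0 la 0)%N.
  by have /is_intpartP[_ pos] := la_part; apply: pos; case: la sum_la {la_part}.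
pose u := cell_at lt_corner; have hook_u := @hook_length_corner _ u la_part erefl erefl.
have le_u := hook_length_leq u la_part; rewrite sum_la in le_u.
rewrite /hook_sum (bigD1 u) //= big1 ?addr0 => [|v neq_vu]; last first.
  apply: g0; rewrite hook_length_gt0 /=; have := hook_length_leq v la_part.
  suff : (0 < crow v + ccol v)%N by lia.
  rewrite lt0n addn_eq0; apply: contraNN neq_vu => /andP[/eqP row_v /eqP col_v].
  by apply/eqP/cell_inj; rewrite ?row_v ?col_v.
rewrite -hook_u eqSS; case: eqP => [-> //|neq_r]; apply: g0.
by rewrite hook_length_gt0; lia.
Qed.

Definition hook_shape (a b : nat) : seq nat := a.+1 :: nseq b 1%N.

Lemma nth_hook_shape a b i :
  nth 0%N (hook_shape a b) i = if i == 0%N then a.+1 else nat_of_bool (i <= b)%N.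
Proof. by case: i => //= i; rewrite nth_nseq; case: ltnP. Qed.

Lemma sumn_hook_shape a b : sumn (hook_shape a b) = (a + b).+1.
Proof. by rewrite /= sumn_nseq mul1n. Qed.

Lemma hook_shape_is_intpart a b : is_intpart (hook_shape a b).
Proof.
apply/is_intpartP; split=> i; rewrite !nth_hook_shape /=.
  by case: eqP => _; case: ltnP => // /ltnW->.
by rewrite size_nseq ltnS => ->; case: eqP.
Qed.

Lemma removable_hook_shape a b i : (0 < a + b)%N -> removable (hook_shape a b) i
  = (i == 0%N) && (0 < a)%N || (i == b) && (0 < b)%N.
Proof.
rewrite /removable !nth_hook_shape /= => ab_gt0.
by case: eqP; case: eqP; case: leqP; case: leqP; lia.
Qed.

Lemma decr_hook_shape_leg a b : decr_part (hook_shape a b.+1) b.+1 = hook_shape a b.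
Proof.
rewrite /decr_part nth_hook_shape leqnn /= /hook_shape; congr (_ :: _).
by rewrite -[_ :: _]/(nseq b.+1 1%N) take_nseq.
Qed.

Lemma big_pred1_cond (V : nmodType) (I : finType) (i : I) (b : bool) (F : I -> V) :
  \sum_(j | (j == i) && b) F j = if b then F i else 0.
Proof.
by case: b; [apply: big_pred1 => j | apply: big_pred0 => j]; rewrite ?andbT ?andbF.
Qed.

Lemma num_SYT_hook_shape_branching a b : (0 < a + b)%N ->
  num_SYT (hook_shape a b)
  = ((if (0 < a)%N then num_SYT (hook_shape a.-1 b) else 0)
     + (if (0 < b)%N then num_SYT (hook_shape a b.-1) else 0))%N.
Proof.
move=> ab_gt0.
rewrite (num_SYT_branching (hook_shape_is_intpart a b) (sumn_hook_shape a b)).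
have lt_b : (b < (a + b).+1)%N by rewrite ltnS leq_addl.
rewrite (bigID (pred1 ord0)) /=; congr addn.
  rewrite (eq_bigl (fun i => (i == ord0) && (0 < a)%N)) => [|i].
    by rewrite big_pred1_cond; case: a {ab_gt0 lt_b}.
  by rewrite removable_hook_shape // -val_eqE /=; lia.
rewrite (eq_bigl (fun i => (i == Ordinal lt_b) && (0 < b)%N)) => [|i].
  rewrite big_pred1_cond /=; case: b {ab_gt0 lt_b} => // b.
  by rewrite decr_hook_shape_leg.
by rewrite removable_hook_shape // -!val_eqE /=; lia.
Qed.

Theorem num_SYT_hook_shape a b : num_SYT (hook_shape a b) = 'C(a + b, b).
Proof.
move ab: (a + b)%N => n; elim: n a b ab => [|n IH] a b ab.
  have [-> ->] : a = 0%N /\ b = 0%N by lia.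
  rewrite (num_SYT_branching (hook_shape_is_intpart 0 0) (sumn_hook_shape 0 0)).
  by rewrite big_mkcond big_ord1 /= num_SYT_nil.
rewrite num_SYT_hook_shape_branching ?ab //; case: a b ab => [|a] [|b] //= ab.
- have -> : b = n by lia.
  by rewrite IH ?binn.
- by rewrite IH ?bin0 //; lia.
by rewrite binS (IH a b.+1) ?(IH a.+1 b) //; lia.
Qed.

Lemma sumn_eq_size (s : seq nat) : 0%N \notin s ->
  (sumn s == size s) = (s == nseq (size s) 1%N).
Proof.
move=> s_pos; apply/eqP/eqP => [|->]; last by rewrite sumn_nseq size_nseq mul1n.
elim: s s_pos => //= p s IH; rewrite inE negb_or eq_sym -lt0n.
move=> /andP[p_gt0 s_pos] sum_s.
have le_s := size_leq_sumn s_pos.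
by rewrite -IH //; [congr (_ :: _); lia | lia].
Qed.

Lemma hook_shapeP n (la : intpart n.+1) (b : 'I_n.+1) :
  (nth 0 la 0 + size la == n.+2)%N && ((size la).-1 == b)
  = (val la == hook_shape (n - b) b).
Proof.
have /andP[_ la_pos] := intpart_is_intpart la; have sum_la := sumn_intpart la.
case: la sum_la la_pos => -[|p mu] la_part //= sum_la.
rewrite inE negb_or => /andP[_ mu_pos]; rewrite eqseq_cons.
have -> : (p + (size mu).+1 == n.+2)%N = (sumn mu == size mu) by apply/eqP/eqP; lia.
rewrite sumn_eq_size //; apply/andP/andP => -[/eqP].
  move=> mu_ones /eqP size_mu; rewrite -size_mu -mu_ones; split=> //.
  have := congr1 sumn mu_ones; rewrite sumn_nseq; have := ltn_ord b.
  by rewrite -size_mu; lia.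
by move=> _ /eqP->; rewrite size_nseq !eqxx.
Qed.

Lemma sum_hook_shapes (V : nmodType) n (F : seq nat -> V) :
  \sum_(la : intpart n.+1 | (nth 0 la 0 + size la == n.+2)%N) F la
  = \sum_(b < n.+1) F (hook_shape (n - b) b).
Proof.
pose tail_size (la : intpart n.+1) : 'I_n.+1 := inord (size la).-1.
rewrite (partition_big tail_size xpredT) //=.
apply: eq_bigr => b _; have le_b : (b <= n)%N by rewrite -ltnS.
rewrite (eq_bigl (fun la : intpart n.+1 => val la == hook_shape (n - b) b)) => [|la].
  by rewrite big_intpart1 hook_shape_is_intpart sumn_hook_shape subnK // eqxx.
rewrite -hook_shapeP /tail_size -val_eqE /= inordK //.
have := size_intpart_leq (intpart_is_intpart la); rewrite sumn_intpart.
by case: size.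
Qed.

(** * The average of the hook polynomial *)

Definition hook_poly (r : nat) : {poly rat} :=
  \prod_(1 <= i < r.+1) ('X^2 - (i%:R ^+ 2)%:P).

Lemma horner_hook_poly r x :
  (hook_poly r).[x] = \prod_(1 <= i < r.+1) (x ^+ 2 - i%:R ^+ 2).
Proof. by rewrite horner_prod; apply: eq_bigr => i _; rewrite !hornerE. Qed.

Lemma even_hook_poly r : even_function (horner (hook_poly r)).
Proof.
by move=> x; rewrite !horner_hook_poly; apply: eq_bigr => i _; rewrite sqrrN.
Qed.

Lemma size_hook_poly r : size (hook_poly r) = r.*2.+1.
Proof.
elim: r => [|r IH]; first by rewrite /hook_poly big_geq // size_poly1.
rewrite /hook_poly big_nat_recr //= -/(hook_poly r).
rewrite size_Mmonic ?monicXnsubC // -?size_poly_gt0 ?IH // size_XnsubC //.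
by rewrite addnS /= doubleS addn2.
Qed.

Lemma hook_poly_eq0 r h : (0 < h <= r)%N -> (hook_poly r).[h%:R] = 0.
Proof.
move=> lt_h; rewrite horner_hook_poly (bigD1_seq h) ?iota_uniq ?mem_index_iota //=.
by rewrite subrr mul0r.
Qed.

Lemma hook_poly_top r :
  2 * r.+1%:R ^+ 2 * (hook_poly r).[r.+1%:R] = (r.*2.+2)`!%:R.
Proof.
have prodB : \prod_(1 <= i < r.+1) (r.+1%:R - i%:R) = r`!%:R :> rat.
  rewrite fact_prod natr_prod big_nat_rev /=; apply: eq_big_nat => i lt_i.
  by rewrite -natrB; [congr _%:R; lia | lia].
have prodD : (r.+1)`!%:R * \prod_(1 <= i < r.+1) (r.+1%:R + i%:R)
    = (r.*2.+1)`!%:R :> rat.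
  rewrite (@fact_split r.*2.+1 r.+1); last by lia.
  rewrite natrM natr_prod -[in RHS](add1n r.+1) big_addn.
  have -> : (r.*2.+2 - r.+1 = r.+1)%N by lia.
  by congr (_ * _); apply: eq_bigr => i _; rewrite natrD addrC.
rewrite horner_hook_poly; under eq_bigr do rewrite subr_sqr.
rewrite big_split /= prodB [(r.*2.+2)`!]factS natrM -prodD factS natrM.
have -> : r.*2.+2%:R = 2 * r.+1%:R :> rat by rewrite -natrM; congr (_%:R); lia.
by ring.
Qed.

Definition hook_mean r : nat -> rat :=
  plancherel_mean (hook_sum (horner (hook_poly r))).

Lemma hook_mean_degree r : degree_lt r.+2 (hook_mean r).
Proof.
have := plancherel_mean_degree (content_poly_hook_sum (@even_hook_poly r)).
by rewrite size_hook_poly /= doubleK.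
Qed.

Lemma hook_mean_eq0 r n : (n <= r)%N -> hook_mean r n = 0.
Proof.
move=> le_nr; rewrite /hook_mean /plancherel_mean big1 ?mulr0 // => la _.
rewrite /hook_sum big1 ?mulr0 // => u _; apply: hook_poly_eq0.
rewrite hook_length_gt0; have := hook_length_leq u (intpart_is_intpart la).
by rewrite sumn_intpart; lia.
Qed.

Lemma hook_mean_top r :
  hook_mean r r.+1 = 'C(r.*2, r)%:R * (hook_poly r).[r.+1%:R] / (r.+1)`!%:R.
Proof.
rewrite /hook_mean /plancherel_mean mulrC; congr (_ / _).
transitivity (\sum_(la : intpart r.+1 | (nth 0 la 0 + size la == r.+2)%N)
                (num_SYT la)%:R ^+ 2 * (hook_poly r).[r.+1%:R]).
  rewrite [RHS]big_mkcond; apply: eq_bigr => la _.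
  rewrite (@hook_sum_corner _ r) ?intpart_is_intpart ?sumn_intpart //.
    by case: ifP; rewrite // mulr0.
  exact: hook_poly_eq0.
rewrite -mulr_suml (sum_hook_shapes r (fun la => (num_SYT la)%:R ^+ 2)).
rewrite -addnn -binomial.Vandermonde natr_sum; congr (_ * _); apply: eq_bigr => b _.
have le_b : (b <= r)%N by rewrite -ltnS.
by rewrite num_SYT_hook_shape subnK // bin_sub // natrM.
Qed.

Lemma central_bin_fact (R : numFieldType) n :
  'C(n.*2, n)%:R = (n.*2)`!%:R / n`!%:R ^+ 2 :> R.
Proof.
have fact_neq0 : n`!%:R != 0 :> R by rewrite pnatr_eq0 -lt0n fact_gt0.
apply: (canRL (mulfK (expf_neq0 2 fact_neq0))).
by rewrite -natrX -natrM -addnn -(bin_fact (leq_addr n n)) addnK.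
Qed.

Lemma prod_falling (R : nzRingType) n k :
  \prod_(0 <= j < k) (n%:R - j%:R) = (n ^_ k)%:R :> R.
Proof.
elim: k => [|k IH]; first by rewrite big_geq.
rewrite big_nat_recr //= IH ffactnSr natrM.
case: (leqP k n) => [le_kn|lt_nk]; first by rewrite natrB.
by rewrite ffact_small // !mul0r.
Qed.

Theorem theorem1 (n r : nat) (hn : (1 <= n)%N) :
  1 / (n`!)%:R *
    (\sum_(la : intpart n) (num_SYT la)%:R ^+ 2 *
       \sum_(u : cell la)
          \prod_(1 <= i < r.+1) ((hook_length u)%:R ^+ 2 - i%:R ^+ 2))
  = 1 / (2 * (r%:R + 1) ^+ 2) * ('C(2 * r, r))%:R * ('C(2 * r + 2, r + 1))%:R *
      \prod_(0 <= j < r.+1) (n%:R - j%:R) :> rat.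
Proof.
transitivity (hook_mean r n).
  rewrite /hook_mean /plancherel_mean div1r; congr (_ * _); apply: eq_bigr => la _.
  by congr (_ * _); apply: eq_bigr => u _; rewrite horner_hook_poly.
rewrite (degree_lt_interpolation (hook_mean_degree r) (@hook_mean_eq0 r)) hook_mean_top.
rewrite prod_falling -bin_ffact natrM natr1 mul2n addn2 addn1.
rewrite -doubleS (central_bin_fact _ r.+1) doubleS -hook_poly_top.
have fact_neq0 : (r.+1)`!%:R != 0 :> rat by rewrite pnatr_eq0 -lt0n fact_gt0.
by field; rewrite fact_neq0 nat1r pnatr_eq0.
Qed.
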